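(* Let $e$ be a nonzero nilpotent element of even depth $d$ in a semisimple Lie algebra $\mathfrak g$ over an algebraically closed field of characteristic $0$, and let $\mathfrak q\subset\mathfrak g$ be a reducing subalgebra for $e$. Then $e$ is of semisimple type in $\mathfrak g$ if and only if $e\in\mathfrak q$ and $e$ is of semisimple type in $\mathfrak q$.
   Context: $G$ is the connected simply connected group with Lie algebra $\mathfrak g$; $\mathfrak s=\{e,h,f\}$ is an $\mathfrak{sl}_2$-triple containing $e$; $\mathfrak g_j$ is the $j$-eigenspace of $\mathrm{ad}\,h$, and the depth $d$ is the largest $j$ with $\mathfrak g_j\ne 0$. A cyclic element associated with $e$ is $e+F$ with $0\ne F\in\mathfrak g_{-d}$; $e$ is of semisimple type if $e+F$ is semisimple for all $F$ in a nonempty Zariski open subset of $\mathfrak g_{-d}$. $Z(\mathfrak s)$ is the centralizer of $\mathfrak s$ in $G$. A reducing subalgebra for $e$ is a semisimple subalgebra $\mathfrak q\subset\mathfrak g$ with $[\mathfrak s,\mathfrak q]\subset\mathfrak q$ such that $Z(\mathfrak s)(\mathfrak q\cap\mathfrak g_{-d})$ is Zariski dense in $\mathfrak g_{-d}$. When $e\in\mathfrak q$, $\mathfrak s\subset\mathfrak q$ may be used to define the type of $e$ in $\mathfrak q$. *)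

(* Defs.v *)
From HB Require Import structures.
From mathcomp Require Import all_boot all_order all_algebra.
From mathcomp Require mpoly.
Set Implicit Arguments. Unset Strict Implicit. Unset Printing Implicit Defensive.
Import GRing.Theory.
Local Open Scope ring_scope.

Section LieDefs.
Variables (F : fieldType) (V : vectType F) (br : V -> V -> V).

Definition is_lie_bracket : Prop :=
  [/\ forall (a : F) x y z, br (a *: x + y) z = a *: br x z + br y z,
      forall (a : F) x y z, br z (a *: x + y) = a *: br z x + br z y,
      forall x, br x x = 0
    & forall x y z, br x (br y z) + br y (br z x) + br z (br x y) = 0].

Definition subalgebra (L : {vspace V}) : Prop :=
  forall x y, x \in L -> y \in L -> br x y \in L.

Definition ideal_of (L I : {vspace V}) : Prop :=
  (I <= L)%VS /\ forall x y, x \in L -> y \in I -> br x y \in I.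

Definition derived (I : {vspace V}) : {vspace V} :=
  <<[seq br x y | x <- vbasis I, y <- vbasis I]>>%VS.

Definition solvable_sub (I : {vspace V}) : Prop :=
  exists n, iter n derived I = 0%VS.

Definition semisimple_sub (L : {vspace V}) : Prop :=
  subalgebra L /\ forall I, ideal_of L I -> solvable_sub I -> I = 0%VS.

Definition ad_nilpotent (L : {vspace V}) (x : V) : Prop :=
  exists n, forall v, v \in L -> iter n (br x) v = 0.

Definition ad_semisimple (L : {vspace V}) (x : V) : Prop :=
  exists s : seq V, [/\ all (fun v => v \in L) s, <<s>>%VS = L &
                        forall v, v \in s -> exists c : F, br x v = c *: v].

Definition sl2_triple (e h f : V) : Prop :=
  [/\ br h e = 2%:R *: e, br h f = - (2%:R *: f) & br e f = h].

Definition grade (L : {vspace V}) (h : V) (j : int) : {vspace V} :=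
  (L :&: lker (linfun (fun v => br h v - j%:~R *: v)))%VS.

Definition is_depth (L : {vspace V}) (h : V) (d : nat) : Prop :=
  grade L h d != 0%VS /\ forall j : int, (d%:Z < j)%R -> grade L h j = 0%VS.

(* Zariski topology on a subspace W, via polynomial functions in the
   coordinates with respect to the basis vbasis W. *)
Definition coords (W : {vspace V}) (v : V) : 'I_(\dim W) -> F :=
  fun i => coord (vbasis W) i v.

Definition zclosed (W : {vspace V}) (C : V -> Prop) : Prop :=
  exists P : mpoly.mpoly (\dim W) F -> Prop,
    forall v, C v <-> (v \in W /\ forall p, P p -> mpoly.meval (@coords W v) p = 0).
End LieDefs.

Section LieDefs2.
Variables (F : closedFieldType) (V : vectType F) (br : V -> V -> V).

Definition zopen (W : {vspace V}) (U : V -> Prop) : Prop :=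
  (forall v, U v -> v \in W) /\ zclosed W (fun v => v \in W /\ ~ U v).

Definition zdense (W : {vspace V}) (S : V -> Prop) : Prop :=
  (forall v, S v -> v \in W) /\
  forall C, zclosed W C -> (forall v, S v -> C v) -> forall v, v \in W -> C v.

(* exp(ad x), for ad-nilpotent x (the sum terminates since (ad x)^dim V = 0) *)
Definition exp_ad (x : V) : V -> V :=
  fun v => \sum_(k < (\dim (fullv : {vspace V})).+1) (k`!%:R)^-1 *: iter k (br x) v.

(* Int(g) = Ad(G): the group generated by the exp(ad x), x nilpotent *)
Inductive inner_aut : (V -> V) -> Prop :=
| ia_exp x : ad_nilpotent br fullv x -> inner_aut (exp_ad x)
| ia_comp phi psi : inner_aut phi -> inner_aut psi -> inner_aut (phi \o psi).

(* image of Z(s) in Ad(G): elements of Int(g) fixing e, h, f *)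
Definition Zs (e h f : V) (phi : V -> V) : Prop :=
  [/\ inner_aut phi, phi e = e, phi h = h & phi f = f].

Definition semisimple_type (L : {vspace V}) (e h f : V) : Prop :=
  exists d : nat, is_depth br L h d /\
    exists U : V -> Prop, [/\ zopen (grade br L h (- d%:Z)) U, exists F0, U F0
      & forall F0, U F0 -> ad_semisimple br L (e + F0)].

Definition reducing (q : {vspace V}) (e h f : V) (d : nat) : Prop :=
  [/\ semisimple_sub br q,
      forall x, x \in q -> [/\ br e x \in q, br h x \in q & br f x \in q]
    & zdense (grade br fullv h (- d%:Z))
        (fun v => exists phi u, [/\ Zs e h f phi, u \in (q :&: grade br fullv h (- d%:Z))%VS
                                  & v = phi u])].
End LieDefs2.

(* Main.v *)
Require Import Defs.
From HB Require Import structures.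
From mathcomp Require Import all_boot all_order all_algebra.
From mathcomp Require Import ring mpoly.
From Stdlib Require Import Classical.
Set Implicit Arguments. Unset Strict Implicit. Unset Printing Implicit Defensive.
Import Order.TTheory GRing.Theory Num.Theory.
Local Open Scope ring_scope.

(** Write x = e + u with u in the lowest graded piece of q.

    If x is semisimple in g, split e = e' + e'' and h = h' + h'' along
    N(q) = q + Z(q), which is available because the Killing form of g is
    nondegenerate on q (Cartan's criterion).  Then [x, h''] = -2 e'' and
    [x, e''] = 0, so e'' lies both in the kernel and in the image of ad x; hence
    e'' = 0 and e is in q.

    Conversely let e be in q and x semisimple in q.  The nilpotent part of ad x
    is ad n, where n centralizes q, hence commutes with h.  If t^(d+2) = 1, then
    t^h multiplies x, hence n, by t^2; as it also fixes n, choosing t^2 <> 1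
    gives n = 0 and x is semisimple in g.

    The group Z(s) and the density hypothesis carry generic points of one lowest
    graded piece to the other.  Density of the set of v with e + v semisimple
    suffices: the rank of (tr A^(i+j)) is at most the degree of the minimal
    polynomial of A, with equality exactly when A is semisimple; the bound
    "degree <= m" passes to the Zariski closure, while "rank >= m" is open. *)

(** * Spectral calculus of a matrix *)


(** Several obstacles shape the argument. The field carries no conjugation, so Cartan's criterion
    tests the eigenvalues of ad x against rational-valued additive functionals, for which positivity
    of squares is available. Neither e in q nor h in q is given, nor is the depth of q: density only
    provides a nonzero vector of weight -d in q, which sl2-theory reflects inside q to weight d.
    Elements of Z(s) carry an open set of q to a union of images only known to be dense, while
    semisimple type asks for an open set; hence the detour through ranks. The Jordan decomposition
    enters only through generalized eigenvectors of ad x, on which the semisimple part is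
    multiplication by the eigenvalue; it is inner because every derivation of g is. The exponent d +
    2 is the difference between the weight 2 of e and the weight -d of u. *)

Section Spectrum.
Variables (F : closedFieldType) (n : nat).
Implicit Types (A : 'M[F]_n.+1) (p : {poly F}) (v : 'cV[F]_n.+1).

(** Eigenvalues are listed with algebraic multiplicity, so that traces and determinants are sums and
    products over the list. *)
Definition spectrum A : seq F := sval (closed_field_poly_normal (char_poly A)).

Lemma char_poly_spectrum A :
  char_poly A = \prod_(z <- spectrum A) ('X - z%:P).
Proof.
rewrite /spectrum; case: closed_field_poly_normal => r /= ->.
rewrite [in LHS](_ : lead_coef _ = 1) ?scale1r //.
by have /monicP := char_poly_monic A.
Qed.

Lemma size_spectrum A : size (spectrum A) = n.+1.
Proof.
have := size_char_poly A.
by rewrite char_poly_spectrum size_prod_XsubC => -[].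
Qed.

Lemma mem_spectrum A z : (z \in spectrum A) = root (char_poly A) z.
Proof. by rewrite char_poly_spectrum root_prod_XsubC. Qed.

Lemma horner_char_poly A y : (char_poly A).[y] = \det (y%:M - A).
Proof.
rewrite /char_poly -[_.[y]]/(horner_eval y _) -det_map_mx; congr (\det _).
apply/matrixP=> i j; rewrite !mxE /= /horner_eval hornerD hornerN hornerC.
by case: (i == j); rewrite ?mulr1n ?mulr0n ?hornerX ?horner0.
Qed.

(** Both sides are multiplicative in [p]; for a linear factor the determinant is, up to sign, a
    value of the characteristic polynomial. *)
Lemma det_horner_mx A p :
  \det (horner_mx A p) = \prod_(z <- spectrum A) p.[z].
Proof.
have [r ->] := closed_field_poly_normal p.
move: (lead_coef p) => c; rewrite linearZ /= detZ.
under [RHS]eq_bigr do rewrite hornerZ.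
rewrite big_split /= big_const_seq count_predT size_spectrum iter_mulr_1.
congr (_ * _); elim: r => [|a r IH].
  under [RHS]eq_bigr do rewrite big_nil hornerC.
  by rewrite big_nil rmorph1 det1 big1.
under [RHS]eq_bigr do rewrite big_cons hornerM hornerXsubC.
rewrite big_cons rmorphM /= det_mulmx IH big_split /=; congr (_ * _).
rewrite rmorphB /= horner_mx_X horner_mx_C -opprB -scaleN1r detZ.
rewrite -horner_char_poly char_poly_spectrum horner_prod.
rewrite -(size_spectrum A); elim: (spectrum A) => [|z s IHs].
  by rewrite !big_nil mul1r.
by rewrite !big_cons -IHs /= exprS hornerXsubC mulrACA mulN1r opprB.
Qed.

(** The value at y of the left side is the determinant of the polynomial y - p taken at [A], and a
    nonzero difference would have a point where it does not vanish. *)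
Lemma char_poly_horner_mx A p :
  char_poly (horner_mx A p) = \prod_(z <- spectrum A) ('X - (p.[z])%:P).
Proof.
apply/eqP; rewrite -subr_eq0; apply: contraT => /closed_nonrootP [y].
rewrite rootE hornerD hornerN horner_char_poly -(horner_mx_C A) -rmorphB /=.
rewrite det_horner_mx horner_prod subr_eq0 => /eqP []; apply: eq_bigr => z _.
by rewrite hornerXsubC hornerD hornerN hornerC.
Qed.

Lemma trace_horner_mx A p :
  \tr (horner_mx A p) = \sum_(z <- spectrum A) p.[z].
Proof.
have := char_poly_trace (horner_mx A p) (ltn0Sn n).
rewrite char_poly_horner_mx -(big_map (fun z => p.[z]) predT (fun z => 'X - z%:P)).
have sz : size [seq p.[z] | z <- spectrum A] = n.+1 by rewrite size_map size_spectrum.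
have := @coefPn_prod_XsubC F [seq p.[z] | z <- spectrum A].
by rewrite sz => -> // /oppr_inj <-; rewrite big_map.
Qed.

Lemma mem_spectrumP A z v :
  A *m v = z *: v -> v != 0 -> z \in spectrum A.
Proof.
move=> Av v0; rewrite mem_spectrum rootE horner_char_poly.
apply: contraNT v0; rewrite -unitfE -[_ \is a GRing.unit]/(_ \in unitmx) => U.
rewrite -[v](mulKmx U) mulmxBl Av mul_scalar_mx subrr mulmx0 //.
Qed.

Lemma spectrum_eigenvector A z : z \in spectrum A ->
  exists2 v : 'cV[F]_n.+1, v != 0 & A *m v = z *: v.
Proof.
rewrite mem_spectrum rootE horner_char_poly -det_tr => /det0P [w w0 /(congr1 trmx)].
rewrite trmx_mul trmxK trmx0 mulmxBl mul_scalar_mx => /eqP.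
rewrite subr_eq0 => /eqP E; exists w^T => //.
by rewrite -(inj_eq trmx_inj) trmxK trmx0.
Qed.

Lemma coprime_killed A p q v : coprimep p q ->
  horner_mx A p *m v = 0 -> horner_mx A q *m v = 0 -> v = 0.
Proof.
move/Bezout_eq1_coprimepP => [[a b] /= ab] pv qv.
rewrite -[v]mul1mx -[1%:M]/(1 : 'M_n.+1) -(rmorph1 (horner_mx A)) -ab.
rewrite rmorphD !rmorphM /= mulmxDl -!mulmxA pv qv !mulmx0 addr0 //.
Qed.

End Spectrum.

(** Induction by Bezout between the power at the new point [x] and the product [D] over the rest:
    [b * D] serves [x], and the old [e z] are multiplied by the complementary term. At a matrix
    annihilated by the whole product these polynomials become the projections onto its generalized
    eigenspaces. *)
Lemma partition_of_unity (F : fieldType) (s : seq F) (K : nat) : uniq s ->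
  exists e : F -> {poly F},
    \prod_(z <- s) ('X - z%:P) ^+ K %| 1 - \sum_(z <- s) e z /\
    forall z, z \in s ->
      \prod_(z <- s) ('X - z%:P) ^+ K %| ('X - z%:P) ^+ K * e z.
Proof.
elim: s => [|x s IH] /=.
  by exists (fun=> 0); rewrite !big_nil dvd1p.
case/andP=> xs us; have [e [e1 e2]] := IH us.
set D := \prod_(z <- s) _ in e1 e2 *.
have cop : coprimep (('X - x%:P) ^+ K) D.
  rewrite /D big_seq; apply: (big_ind (coprimep _)).
  - exact: coprimep1.
  - by move=> p q cp cq; rewrite coprimepMr cp.
  move=> z zs; apply/coprimep_expl/coprimep_expr.
  rewrite coprimep_XsubC root_XsubC; by apply: contraNneq xs => <-.
have [[a b] /= ab] := Bezout_eq1_coprimepP _ _ cop.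
exists (fun z => if z == x then b * D else a * ('X - x%:P) ^+ K * e z).
rewrite !big_cons -/D eqxx.
have -> : \sum_(j <- s) (if j == x then b * D else a * ('X - x%:P) ^+ K * e j)
   = a * ('X - x%:P) ^+ K * \sum_(j <- s) e j.
  rewrite mulr_sumr; apply: eq_big_seq => z zs.
  by case: eqP => // zx; rewrite -zx zs in xs.
split.
  have -> : 1 - (b * D + a * ('X - x%:P) ^+ K * (\sum_(j <- s) e j))
    = a * (('X - x%:P) ^+ K * (1 - \sum_(j <- s) e j)).
    by rewrite -{1}ab opprD addrA addrK mulrA mulrBr mulr1.
  by rewrite dvdp_mull // dvdp_mul.
move=> z; rewrite inE; case: eqP => [-> _|_ /= zs].
  by rewrite mulrCA dvdp_mull.
by rewrite -[a * _ * _]mulrA mulrCA dvdp_mull // mulrCA dvdp_mul // e2.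
Qed.

(** * Functions of a matrix and the trace criterion for diagonalizability *)

Section SpectralCalculus.
Variables (F : closedFieldType) (n : nat).
Implicit Types (A : 'M[F]_n.+1) (p : {poly F}) (v : 'cV[F]_n.+1).

Lemma dvdp_horner_mx0 A p q : p %| q -> horner_mx A p = 0 -> horner_mx A q = 0.
Proof. by case/dvdpP=> r -> p0; rewrite rmorphM /= p0 mulr0. Qed.

Lemma mul_horner_mx A p q v :
  horner_mx A p *m (horner_mx A q *m v) = horner_mx A (p * q) *m v.
Proof. by rewrite mulmxA rmorphM. Qed.

Lemma annihilator_decomposition A s K : uniq s ->
  horner_mx A (\prod_(z <- s) ('X - z%:P) ^+ K) = 0 ->
  exists e : F -> {poly F}, \sum_(z <- s) horner_mx A (e z) = 1 /\
    forall z, z \in s -> horner_mx A (('X - z%:P) ^+ K * e z) = 0.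
Proof.
move=> us D0; have [e [e1 e2]] := partition_of_unity K us.
exists e; split=> [|z zs]; last by apply: dvdp_horner_mx0 D0; apply: e2.
have := dvdp_horner_mx0 e1 D0.
by rewrite rmorphB /= rmorph1 rmorph_sum => /eqP; rewrite subr_eq0 => /eqP.
Qed.

Lemma generalized_eigen_decomposition A :
  exists e : F -> {poly F},
    \sum_(z <- undup (spectrum A)) horner_mx A (e z) = 1 /\
    forall z, z \in undup (spectrum A) ->
      horner_mx A (('X - z%:P) ^+ n.+1 * e z) = 0.
Proof.
apply: annihilator_decomposition; first exact: undup_uniq.
apply: dvdp_horner_mx0 (Cayley_Hamilton A).
rewrite char_poly_spectrum -prodr_undup_exp_count.
elim/big_ind2 : _ => [|p q p' q'|z _]; first exact: dvdpp.
  exact: dvdp_mul.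
by apply: dvdp_exp2l; rewrite -(size_spectrum A) count_size.
Qed.

(** The projections onto the generalized eigenspaces are polynomials in [A], so they may be combined
    with arbitrary coefficients [phi]. The identity gives the semisimple part; other choices give
    the derivations of Cartan's criterion and the operator t^h. *)
Lemma spectral_function A (phi : F -> F) :
  exists p, forall z k v, horner_mx A (('X - z%:P) ^+ k) *m v = 0 ->
    horner_mx A p *m v = phi z *: v.
Proof.
have [e [e1 e2]] := generalized_eigen_decomposition A.
exists (\sum_(y <- undup (spectrum A)) phi y *: e y) => z k v vz.
rewrite rmorph_sum /= mulmx_suml -[v in RHS]mul1mx -[1%:M]/(1 : 'M_n.+1) -e1.
rewrite mulmx_suml scaler_sumr; apply: eq_big_seq => y ys.
rewrite linearZ /= -scalemxAl; case: (eqVneq y z) => [-> //|yz].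
suff -> : horner_mx A (e y) *m v = 0 by rewrite !scaler0.
apply: (@coprime_killed _ _ A (('X - y%:P) ^+ n.+1) (('X - z%:P) ^+ k)).
- by apply/coprimep_expl/coprimep_expr; rewrite coprimep_XsubC root_XsubC eq_sym.
- by rewrite mul_horner_mx e2 // mul0mx.
by rewrite mul_horner_mx mulrC -mul_horner_mx vz mulmx0.
Qed.

(** Gram matrix, in the monomial basis, of the trace form tr(p(A) q(A)) on polynomials of degree at
    most n. *)
Definition hankel A : 'M[F]_n.+1 := \matrix_(i, j) \tr (A ^+ (i + j)).

(** The squarefree part of the characteristic polynomial; it annihilates [A] exactly when [A] is
    diagonalizable. *)
Definition radical A : {poly F} := \prod_(z <- undup (spectrum A)) ('X - z%:P).

Lemma mul_hankel A (u : 'rV_n.+1) j :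
  (u *m hankel A) 0 j = \sum_(z <- spectrum A) (rVpoly u).[z] * z ^+ j.
Proof.
transitivity (\tr (horner_mx A (rVpoly u * 'X^j))).
  rewrite rmorphM /= horner_rVpoly (mulmx_sum_row _ (powers_mx _ _)).
  rewrite linear_sum /= mulr_suml.
  rewrite rmorphXn /= horner_mx_X linear_sum /= mxE; apply: eq_bigr => i _.
  rewrite mxE linearZ /= rowK mxvecK -scalerAl mxtraceZ exprD //.
rewrite trace_horner_mx; apply: eq_bigr => z _.
by rewrite hornerM hornerXn.
Qed.

Lemma mul_powers_mx A (u : 'rV_n.+1) :
  (u *m powers_mx A n.+1 == 0) = (horner_mx A (rVpoly u) == 0).
Proof. by rewrite horner_rVpoly vec_mx_eq0. Qed.

Lemma kermx_powers_hankel A :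
  (kermx (powers_mx A n.+1) <= kermx (hankel A))%MS.
Proof.
apply/rV_subP => u /sub_kermxP/eqP; rewrite mul_powers_mx => /eqP u0.
apply/sub_kermxP/rowP => j; rewrite mul_hankel mxE.
transitivity (\tr (horner_mx A (rVpoly u * 'X^j))); last first.
  by rewrite rmorphM /= u0 mul0r mxtrace0.
by rewrite trace_horner_mx; apply: eq_bigr => z _; rewrite hornerM hornerXn.
Qed.

Lemma root_radical A z : root (radical A) z = (z \in spectrum A).
Proof. by rewrite root_prod_XsubC mem_undup. Qed.

(** Row vectors are read as polynomials of degree at most n. The kernel of the powers consists of
    those annihilating [A]; the kernel of the Hankel matrix consists of those vanishing on the
    spectrum, since multiplicities are nonzero in characteristic 0. As the first kernel lies in the
    second, the rank inequality says that they are equal. *)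
Lemma radical_hankel A (charF0 : [pchar F] =i pred0) :
  horner_mx A (radical A) = 0 <->
  (\rank (powers_mx A n.+1) <= \rank (hankel A))%N.
Proof.
split=> [rA|le_rank].
  suff /mxrankS : (kermx (hankel A) <= kermx (powers_mx A n.+1))%MS.
    by rewrite !mxrank_ker leq_sub2lE // rank_leq_row.
  apply/rV_subP => u /sub_kermxP uH; apply/sub_kermxP/eqP; rewrite mul_powers_mx.
  apply/eqP; apply: dvdp_horner_mx0 rA.
  apply: uniq_roots_dvdp; last by rewrite uniq_rootsE undup_uniq.
  apply/allP => y; rewrite mem_undup => ys.
  (* An interpolation polynomial isolating [y]: paired with [u] it leaves only the multiplicity of
     [y] times u(y) g(y). *)
  pose g := \prod_(z <- rem y (undup (spectrum A))) ('X - z%:P).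
  have szg : (size g <= n.+1)%N.
    rewrite size_prod_XsubC size_rem ?mem_undup // prednK; last first.
      by rewrite lt0n size_eq0; apply/eqP=> E; move: ys; rewrite -mem_undup E.
    by rewrite -(size_spectrum A) size_undup.
  have : \sum_(z <- spectrum A) (rVpoly u).[z] * g.[z] = 0.
    transitivity (\sum_(j < n.+1) g`_j * (u *m hankel A) 0 j); last first.
      by rewrite uH big1 // => j _; rewrite mxE mulr0.
    under [RHS]eq_bigr do rewrite mul_hankel mulr_sumr.
    rewrite exchange_big /=; apply: eq_bigr => z _.
    rewrite (horner_coef_wide z szg) mulr_sumr; apply: eq_bigr => j _.
    by rewrite mulrCA.
  rewrite (bigID (pred1 y)) /= [X in _ + X]big_seq_cond [X in _ + X]big1 ?addr0; last first.
    move=> z /andP [zs zy]; suff /eqP -> : root g z by rewrite mulr0.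
    by rewrite root_prod_XsubC mem_rem_uniq ?undup_uniq // inE zy mem_undup.
  rewrite (eq_bigr (fun=> (rVpoly u).[y] * g.[y])); last by move=> z /eqP ->.
  rewrite big_const_seq iter_addr_0 -mulr_natr => /eqP; rewrite !mulf_eq0 => /orP [/orP [//|gy]|].
    have : root g y by [].
    by rewrite root_prod_XsubC mem_rem_uniq ?undup_uniq // inE eqxx.
  by rewrite (pcharf0P _).1 // -leqn0 leqNgt -has_count has_pred1 ys.
have E : (kermx (hankel A) <= kermx (powers_mx A n.+1))%MS.
  have [_ H] := mxrank_leqif_sup (kermx_powers_hankel A).
  rewrite -H eqn_leq mxrankS ?kermx_powers_hankel //= !mxrank_ker.
  by rewrite leq_sub2l.
(* Either the radical has degree at most n and is itself a row vector of the kernel, or all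
   eigenvalues are distinct and it is the characteristic polynomial. *)
have [szr|szr] := ltnP (size (radical A)) n.+2.
  have : ((poly_rV (radical A) : 'rV_n.+1) <= kermx (hankel A))%MS.
    apply/sub_kermxP/rowP => j; rewrite mul_hankel mxE poly_rV_K // big_seq big1 //.
    move=> z; rewrite -root_radical => /eqP -> ; exact: mul0r.
  move/submx_trans=> /(_ _ _ E) /sub_kermxP/eqP.
  by rewrite mul_powers_mx poly_rV_K // => /eqP.
suff -> : radical A = char_poly A by exact: Cayley_Hamilton.
rewrite char_poly_spectrum /radical undup_id //.
move: szr; rewrite size_prod_XsubC ltnS -(size_spectrum A) leqNgt => szr.
by apply: contraNT szr; rewrite ltn_size_undup.
Qed.

End SpectralCalculus.

(** * Rational functionals on finite sets of scalars *)


Lemma ex_max_nat (P : nat -> Prop) (N : nat) :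
  (exists k, P k) -> (forall k, P k -> (k <= N)%N) ->
  exists m, P m /\ forall k, P k -> (k <= m)%N.
Proof.
case=> k0 Pk0 bnd; have [m] := ubnP (N - k0).
elim: m k0 Pk0 => // m IH k0 Pk0 lt_m.
have [[k [Pk lt_k]]|H] := classic (exists k, P k /\ (k0 < k)%N).
  apply: (IH k Pk); rewrite -ltnS; apply: leq_trans lt_m.
  by rewrite ltnS ltn_sub2l // (leq_trans lt_k (bnd _ Pk)).
exists k0; split=> // k Pk; rewrite leqNgt; apply/negP => lt_k.
by apply: H; exists k.
Qed.

Section RationalFunctionals.
Variables (F : fieldType) (charF0 : [pchar F] =i pred0).

Lemma intr_eq0_char0 (m : int) : (m%:~R == 0 :> F) = (m == 0).
Proof.
case: m => m; first by rewrite -pmulrn (pcharf0P F).1.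
by rewrite NegzE mulrNz oppr_eq0 -pmulrn (pcharf0P F).1.
Qed.

(** Any integral fraction representing [q] may be used, which reduces the morphism laws below to
    identities between integers. *)
Lemma ratr_char0 (q : rat) (a b : int) : b != 0 ->
  q * b%:~R = a%:~R -> ratr q * b%:~R = a%:~R :> F.
Proof.
move=> b0 qE; rewrite /ratr.
have dF : (denq q)%:~R != 0 :> F by rewrite intr_eq0_char0 denq_neq0.
apply: (mulIf dF); rewrite mulrAC divfK // -!intrM; congr (_%:~R).
apply: (@intr_inj rat); rewrite !intrM -qE numqE mulrAC //.
Qed.

Lemma ratr_char0_add (p q : rat) : ratr (p + q) = ratr p + ratr q :> F.
Proof.
have d0 : denq p * denq q != 0 by rewrite mulf_neq0 // denq_neq0.
have dF : (denq p * denq q)%:~R != 0 :> F by rewrite intr_eq0_char0.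
apply: (mulIf dF).
rewrite (@ratr_char0 _ (numq p * denq q + numq q * denq p)) //.
  rewrite mulrDl intrD; congr (_ + _).
    by rewrite intrM [in RHS]intrM mulrA (@ratr_char0 _ (numq p)) ?denq_neq0 ?numqE.
  by rewrite !intrM [(denq p)%:~R * _]mulrC mulrA (@ratr_char0 _ (numq q)) ?denq_neq0 ?numqE.
by rewrite intrD !intrM !numqE mulrDl !mulrA; congr (_ + _); rewrite mulrAC.
Qed.

Lemma ratr_char0_mul (p q : rat) : ratr (p * q) = ratr p * ratr q :> F.
Proof.
have d0 : denq p * denq q != 0 by rewrite mulf_neq0 // denq_neq0.
have dF : (denq p * denq q)%:~R != 0 :> F by rewrite intr_eq0_char0.
apply: (mulIf dF).
rewrite (@ratr_char0 _ (numq p * numq q)) //.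
  rewrite !intrM mulrACA (@ratr_char0 p (numq p)) ?denq_neq0 ?numqE //.
  by rewrite (@ratr_char0 q (numq q)) ?denq_neq0 ?numqE.
by rewrite !intrM !numqE mulrACA.
Qed.

Fact ratr_char0_zmod_morphism : zmod_morphism (@ratr F).
Proof.
move=> p q; apply: (addIr (ratr q)).
by rewrite -ratr_char0_add !subrK.
Qed.

Fact ratr_char0_monoid_morphism : monoid_morphism (@ratr F).
Proof. by split; [exact: ratr_nat 1%N | exact: ratr_char0_mul]. Qed.

Definition rat_embedding : {rmorphism rat -> F} :=
  HB.pack (@ratr F)
    (GRing.isZmodMorphism.Build rat F (@ratr F) ratr_char0_zmod_morphism)
    (GRing.isMonoidMorphism.Build rat F (@ratr F) ratr_char0_monoid_morphism).

Local Notation "A ^f" := (map_mx rat_embedding A).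

(** Among matrices of rational relations one of maximal rank is taken; adjoining a further relation
    cannot enlarge its row space. *)
Lemma maximal_rational_relations N (mu : 'cV[F]_N) :
  exists K : 'M[rat]_N, K^f *m mu = 0 /\
    forall c : 'rV[rat]_N, c^f *m mu = 0 -> (c <= K)%MS.
Proof.
have [||r [[K [K0 rK]] rmax]] := @ex_max_nat
  (fun r => exists K : 'M[rat]_N, K^f *m mu = 0 /\ \rank K = r) N.
- by exists 0%N, 0; rewrite map_mx0 mul0mx mxrank0.
- by move=> k [K [_ <-]]; rewrite rank_leq_row.
exists K; split=> // c c0.
have Kc_c : (c <= K + c)%MS by apply: addsmxSr.
have Kc0 : ((K + c)%MS)^f *m mu = 0.
  have /submxP [D ->] : (K + c <= col_mx K c)%MS by rewrite addsmxE.
  by rewrite map_mxM map_col_mx -mulmxA mul_col_mx K0 c0 col_mx0 mulmx0.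
apply: submx_trans Kc_c _.
have [_ <-] := mxrank_leqif_sup (addsmxSl K c).
rewrite eqn_leq mxrankS ?addsmxSl //= rK; apply: rmax.
by exists (K + c)%MS.
Qed.

(* A functional killing all rational relations among the elements of s is
   additive on s; applied to [sum z phi(z) = 0] it turns that identity into a
   vanishing sum of rational squares. *)
Lemma additive_functionals_detect_zero (s : seq F) :
  (forall phi : F -> F,
     (forall a b, a \in s -> b \in s -> a + b \in s -> phi (a + b) = phi a + phi b) ->
     \sum_(z <- s) z * phi z = 0) ->
  forall z, z \in s -> z = 0.
Proof.
move=> H; pose N := size s; pose mu : 'cV[F]_N := \col_i s`_i.
have [K [K0 Kmax]] := maximal_rational_relations mu.
suff KU : K \in unitmx.
  have mu0 : mu = 0.
    by rewrite -[mu]mul1mx -(map_mx1 rat_embedding) -(mulVmx KU) map_mxM -mulmxA K0 mulmx0.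
  move=> z zs; have zN : (index z s < N)%N by rewrite index_mem.
  have := congr1 (fun A : 'cV[F]_N => A (Ordinal zN) 0) mu0.
  by rewrite !mxE /= nth_index.
rewrite -unitmx_tr -row_free_unit -kermx_eq0; apply/rowV0P => v /sub_kermxP vK.
(* Since [v] is killed by the transpose of [K], it is orthogonal to every rational relation; hence
   s_i -> v_i is well defined and additive. *)
have orth (c : 'rV_N) : c^f *m mu = 0 -> c *m v^T = 0.
  move=> /Kmax /submxP [D ->].
  by rewrite -mulmxA -[K]trmxK -trmx_mul vK trmx0 mulmx0.
have delta_mu (i : 'I_N) : (delta_mx 0 i)^f *m mu = (s`_i)%:M :> 'M_1.
  by rewrite map_delta_mx -rowE; apply/matrixP => a b; rewrite !ord1 !mxE mulr1n.
have delta_v (i : 'I_N) : delta_mx 0 i *m v^T = (v 0 i)%:M :> 'M_1.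
  by rewrite -rowE; apply/matrixP => a b; rewrite !ord1 !mxE mulr1n.
have rel2 (i j : 'I_N) : s`_i = s`_j -> v 0 i = v 0 j.
  move=> ij; have /orth : (delta_mx 0 i - delta_mx 0 j : 'rV_N)^f *m mu = 0.
    by rewrite map_mxB mulmxBl !delta_mu ij subrr.
  rewrite mulmxBl !delta_v => /matrixP /(_ 0 0); rewrite !mxE !mulr1n => /eqP.
  by rewrite subr_eq0 => /eqP.
have rel3 (i j k : 'I_N) : s`_i + s`_j = s`_k -> v 0 k = v 0 i + v 0 j.
  move=> ij; have /orth : (delta_mx 0 i + delta_mx 0 j - delta_mx 0 k : 'rV_N)^f *m mu = 0.
    by rewrite map_mxB map_mxD mulmxBl mulmxDl !delta_mu -raddfD /= ij subrr.
  rewrite mulmxBl mulmxDl !delta_v => /matrixP /(_ 0 0); rewrite !mxE !mulr1n => /eqP.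
  by rewrite subr_eq0 => /eqP.
(* The value 0 off [s] is never tested; [index] picks one occurrence, and [rel2] shows that the
   choice does not matter. *)
pose psi z := if insub (index z s) is Some i then v 0 i else 0 : rat.
have psiE (i : 'I_N) : psi s`_i = v 0 i.
  have si : s`_i \in s by rewrite mem_nth.
  rewrite /psi insubT ?index_mem // => lt_i.
  by apply: rel2; rewrite /= nth_index.
have : \sum_(z <- s) z * rat_embedding (psi z) = 0.
  apply: H => a b as_ bs abs.
  have E z : z \in s -> exists i : 'I_N, z = s`_i.
    by rewrite -index_mem => zN; exists (Ordinal zN); rewrite /= nth_index // -index_mem.
  have [i ai] := E _ as_; have [j bj] := E _ bs; have [k abk] := E _ abs.
  by rewrite abk ai bj !psiE -rmorphD (rel3 i j k) // -ai -bj.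
rewrite (big_nth 0) big_mkord => sum0.
(* The vanishing sum makes [v] itself a rational relation, hence orthogonal to itself. *)
have /orth : (\row_i v 0 i)^f *m mu = 0.
  apply/matrixP => a b; rewrite !ord1 [RHS]mxE -[RHS]sum0 mxE.
  by apply: eq_bigr => i _; rewrite !mxE psiE mulrC.
move=> /matrixP /(_ 0 0); rewrite !mxE.
under eq_bigr do rewrite !mxE -expr2.
move=> /eqP; rewrite psumr_eq0; last by move=> i _; rewrite sqr_ge0.
move=> /allP v0; apply/rowP => i; rewrite mxE; apply/eqP.
by have := v0 i (mem_index_enum i); rewrite sqrf_eq0.
Qed.

End RationalFunctionals.

(** * Brackets and coordinates *)


Section Bracket.
Variables (F : fieldType) (V : vectType F) (br : V -> V -> V).
Hypothesis Hlie : is_lie_bracket br.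

Lemma br_addl x y z : br (x + y) z = br x z + br y z.
Proof. by case: Hlie => H _ _ _; have := H 1 x y z; rewrite !scale1r. Qed.

Lemma br_addr x y z : br z (x + y) = br z x + br z y.
Proof. by case: Hlie => _ H _ _; have := H 1 x y z; rewrite !scale1r. Qed.

Lemma br0l z : br 0 z = 0.
Proof. by apply: (addrI (br 0 z)); rewrite -br_addl !addr0. Qed.

Lemma br0r z : br z 0 = 0.
Proof. by apply: (addrI (br z 0)); rewrite -br_addr !addr0. Qed.

Lemma br_scalel a x z : br (a *: x) z = a *: br x z.
Proof. by case: Hlie => H _ _ _; have := H a x 0 z; rewrite br0l !addr0. Qed.

Lemma br_scaler a x z : br z (a *: x) = a *: br z x.
Proof. by case: Hlie => _ H _ _; have := H a x 0 z; rewrite br0r !addr0. Qed.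

Lemma br_oppl x z : br (- x) z = - br x z.
Proof. by rewrite -scaleN1r br_scalel scaleN1r. Qed.

Lemma br_oppr x z : br z (- x) = - br z x.
Proof. by rewrite -scaleN1r br_scaler scaleN1r. Qed.

Lemma br_subl x y z : br (x - y) z = br x z - br y z.
Proof. by rewrite br_addl br_oppl. Qed.

Lemma br_subr x y z : br z (x - y) = br z x - br z y.
Proof. by rewrite br_addr br_oppr. Qed.

Lemma br_self x : br x x = 0. Proof. by case: Hlie. Qed.

Lemma br_anti x y : br x y = - br y x.
Proof.
have := br_self (x + y); rewrite br_addl !br_addr !br_self addr0 add0r => /eqP.
by rewrite addr_eq0 => /eqP.
Qed.

Lemma br_jacobi x y z : br x (br y z) = br (br x y) z + br y (br x z).
Proof.
case: Hlie => _ _ _ J; have := J x y z => /eqP.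
rewrite [br z (br x y)]br_anti subr_eq0 [br z x]br_anti br_oppr => /eqP <-.
by rewrite addrNK.
Qed.

Lemma br_suml (I : Type) (r : seq I) (P : pred I) (f : I -> V) z :
  br (\sum_(i <- r | P i) f i) z = \sum_(i <- r | P i) br (f i) z.
Proof. by apply: (big_morph (br^~ z)) => [x y|]; rewrite ?br_addl ?br0l. Qed.

Lemma br_sumr (I : Type) (r : seq I) (P : pred I) (f : I -> V) z :
  br z (\sum_(i <- r | P i) f i) = \sum_(i <- r | P i) br z (f i).
Proof. by apply: (big_morph (br z)) => [x y|]; rewrite ?br_addr ?br0r. Qed.

Lemma br_linearr x : linear (br x).
Proof. by move=> a u v; rewrite br_addr br_scaler. Qed.

Lemma subalg_memr (L U : {vspace V}) x :
  (forall y, y \in vbasis L -> br x y \in U) -> forall y, y \in L -> br x y \in U.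
Proof.
move=> H y /coord_vbasis ->; rewrite br_sumr memv_suml // => i _.
by rewrite br_scaler memvZ // H // mem_nth // size_tuple.
Qed.

Lemma mem_derived (I : {vspace V}) x y :
  x \in I -> y \in I -> br x y \in derived br I.
Proof.
move=> /coord_vbasis -> yI; rewrite br_suml memv_suml // => i _.
rewrite br_scalel memvZ //; move: y yI; apply: subalg_memr => y yI.
apply: memv_span; apply/allpairsP; exists ((vbasis I)`_i, y).
by split=> //=; rewrite mem_nth // size_tuple.
Qed.

Lemma derived_sub (I U : {vspace V}) :
  (forall x y, x \in I -> y \in I -> br x y \in U) -> (derived br I <= U)%VS.
Proof.
move=> H; apply/span_subvP => _ /allpairsP [[x y] [/= xI yI ->]].
by apply: H; apply: vbasis_mem.
Qed.

Definition shift x z v := br x v - z *: v.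

Lemma shift_linear x z : linear (shift x z).
Proof.
move=> a u v; rewrite /shift br_addr br_scaler !scalerDr !scalerN.
by rewrite opprD addrACA !scalerA [z * a]mulrC.
Qed.

Lemma iter_shift_linear k x z : linear (iter k (shift x z)).
Proof. by elim: k => [|k IH] a u v //=; rewrite IH shift_linear. Qed.

Lemma iter_shift0 k x z : iter k (shift x z) 0 = 0.
Proof. by elim: k => //= k ->; rewrite /shift br0r scaler0 subr0. Qed.

Lemma iter_shiftD k x z u v :
  iter k (shift x z) (u + v) = iter k (shift x z) u + iter k (shift x z) v.
Proof. by have := iter_shift_linear k x z 1 u v; rewrite !scale1r. Qed.

Lemma iter_shiftZ k x z a v :
  iter k (shift x z) (a *: v) = a *: iter k (shift x z) v.
Proof. by have := iter_shift_linear k x z a v 0; rewrite iter_shift0 !addr0. Qed.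

Lemma shift_br x a b v w :
  shift x (a + b) (br v w) = br (shift x a v) w + br v (shift x b w).
Proof.
rewrite /shift br_subl br_subr br_scalel br_scaler br_jacobi scalerDl opprD.
by rewrite addrACA.
Qed.

(** By the twisted Leibniz rule [shift_br], each shift lowers one of the two exponents. *)
Lemma generalized_eigen_br x a b i j v w :
  iter i (shift x a) v = 0 -> iter j (shift x b) w = 0 ->
  iter (i + j) (shift x (a + b)) (br v w) = 0.
Proof.
have [m] := ubnP (i + j)%N; elim: m i j v w => // m IH [|i] [|j] v w lt_m.
- by move=> /= ->; rewrite br0l.
- by move=> /= -> _; rewrite br0l -iterS iter_shift0.
- by move=> _ /= ->; rewrite br0r -iterS iter_shift0.
move=> v0 w0; rewrite addSn iterSr shift_br iter_shiftD.
rewrite (IH i j.+1) -?iterSr // add0r -addSnnS IH -?iterSr //.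
by rewrite addSnnS.
Qed.
End Bracket.

(** * Matrices of ad x and polynomials in ad x *)

Section Coordinates.
Variables (F : closedFieldType) (charF0 : [pchar F] =i pred0).
Variables (V : vectType F) (br : V -> V -> V).
Hypothesis Hlie : is_lie_bracket br.
Variables (n : nat) (X : n.+1.-tuple V) (HX : basis_of fullv X).

Definition to_col (v : V) : 'cV[F]_n.+1 := \col_i coord X i v.

Lemma to_col_linear : linear to_col.
Proof. by move=> a u v; apply/colP => i; rewrite !mxE linearP. Qed.

HB.instance Definition _ :=
  GRing.isLinear.Build F V 'cV[F]_n.+1 *:%R to_col to_col_linear.

Definition of_col (c : 'cV[F]_n.+1) : V := \sum_i c i 0 *: X`_i.

Lemma to_colK : cancel to_col of_col.
Proof.
move=> v; rewrite {2}(coord_basis HX (memvf v)).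
by apply: eq_bigr => i _; rewrite mxE.
Qed.

Lemma of_colK : cancel of_col to_col.
Proof.
move=> c; apply/colP => i; rewrite mxE coord_sum_free //.
by have /basis_free := HX.
Qed.

Lemma to_col_inj : injective to_col. Proof. exact: can_inj to_colK. Qed.

Definition ad (x : V) : 'M[F]_n.+1 := \matrix_(i, j) coord X i (br x X`_j).

Lemma to_col_br x v : to_col (br x v) = ad x *m to_col v.
Proof.
rewrite {1}(coord_basis HX (memvf v)) (br_sumr Hlie) linear_sum /=.
apply/colP => i; rewrite summxE mxE; apply: eq_bigr => j _.
by rewrite br_scaler // linearZ !mxE mulrC.
Qed.

Lemma ad_linear : linear ad.
Proof.
move=> a x y; apply/matrixP => i j.
by rewrite !mxE (br_addl Hlie) (br_scalel Hlie) linearP.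
Qed.

HB.instance Definition _ :=
  GRing.isLinear.Build F V 'M[F]_n.+1 *:%R ad ad_linear.

Definition op (A : 'M[F]_n.+1) (v : V) : V := of_col (A *m to_col v).

Lemma to_col_op A v : to_col (op A v) = A *m to_col v.
Proof. by rewrite of_colK. Qed.

Lemma op_linear A : linear (op A).
Proof.
move=> a u v; apply: to_col_inj; rewrite linearP /= !to_col_op linearP /=.
by rewrite mulmxDr -scalemxAr.
Qed.

HB.instance Definition _ A :=
  GRing.isLinear.Build F V V *:%R (op A) (op_linear A).

Lemma op_ad x v : op (ad x) v = br x v.
Proof. by apply: to_col_inj; rewrite to_col_op to_col_br. Qed.

Lemma opM A B v : op (A *m B) v = op A (op B v).
Proof. by apply: to_col_inj; rewrite !to_col_op mulmxA. Qed.

Lemma opD A B v : op (A + B) v = op A v + op B v.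
Proof. by apply: to_col_inj; rewrite linearD /= !to_col_op mulmxDl. Qed.

Lemma opN A v : op (- A) v = - op A v.
Proof. by apply: to_col_inj; rewrite linearN /= !to_col_op mulNmx. Qed.

Lemma opB A B v : op (A - B) v = op A v - op B v.
Proof. by rewrite opD opN. Qed.

Lemma opC a v : op a%:M v = a *: v.
Proof. by apply: to_col_inj; rewrite linearZ /= to_col_op mul_scalar_mx. Qed.

Lemma op0 v : op 0 v = 0.
Proof. by apply: to_col_inj; rewrite linear0 to_col_op mul0mx. Qed.

Lemma op_sum (I : Type) (r : seq I) (P : pred I) (A : I -> 'M[F]_n.+1) v :
  op (\sum_(i <- r | P i) A i) v = \sum_(i <- r | P i) op (A i) v.
Proof. by apply: (big_morph (op^~ v)) => [B C|]; rewrite ?opD ?op0. Qed.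

Lemma op_inj A B : (forall v, op A v = op B v) -> A = B.
Proof.
move=> H; apply/row_matrixP => i; apply/rowP => j.
have := congr1 to_col (H (of_col (delta_mx j 0))).
by rewrite !to_col_op of_colK -!colE => /colP /(_ i); rewrite !mxE.
Qed.

Lemma ad_br x y : ad (br x y) = ad x *m ad y - ad y *m ad x.
Proof.
apply: op_inj => v; rewrite opB !opM !op_ad.
by rewrite [br x (br y v)](br_jacobi Hlie) addrK.
Qed.

Definition pol x p := op (horner_mx (ad x) p).

HB.instance Definition _ x p :=
  GRing.isLinear.Build F V V *:%R (pol x p) (op_linear (horner_mx (ad x) p)).

Lemma polM x p q v : pol x (p * q) v = pol x p (pol x q v).
Proof. by rewrite /pol rmorphM opM. Qed.

Lemma pol_shift x z k v : pol x (('X - z%:P) ^+ k) v = iter k (shift br x z) v.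
Proof.
elim: k => [|k IH]; first by rewrite /pol rmorph1 opC scale1r.
rewrite exprS polM IH iterS /pol rmorphB /= horner_mx_X horner_mx_C.
by rewrite opB op_ad opC.
Qed.

Lemma pol_stable x (L : {vspace V}) p :
  (forall v, v \in L -> br x v \in L) -> forall v, v \in L -> pol x p v \in L.
Proof.
move=> xL; elim/poly_ind: p => [|p c IH] v vL.
  by rewrite /pol rmorph0 op0 mem0v.
rewrite /pol rmorphD /= opD horner_mx_C opC memvD ?memvZ //.
by rewrite -[op _ _]/(pol _ _ _) polM IH // /pol horner_mx_X op_ad xL.
Qed.

Lemma shift_kernelE x z k v :
  iter k (shift br x z) v = 0 <->
  horner_mx (ad x) (('X - z%:P) ^+ k) *m to_col v = 0.
Proof.
rewrite -pol_shift /pol; split=> [v0|v0]; first by rewrite -to_col_op v0 linear0.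
by apply: to_col_inj; rewrite to_col_op v0 linear0.
Qed.

(** Every vector is a finite sum of generalized eigenvectors, so a property closed under sums need
    only be checked on these. *)
Lemma generalized_eigen_ind x (Q : V -> Prop) :
  Q 0 -> (forall u v, Q u -> Q v -> Q (u + v)) ->
  (forall z k v, iter k (shift br x z) v = 0 -> Q v) -> forall v, Q v.
Proof.
move=> Q0 QD Qz v; have [e [e1 e2]] := generalized_eigen_decomposition (ad x).
have -> : v = \sum_(z <- undup (spectrum (ad x))) pol x (e z) v.
  by rewrite -op_sum e1 opC scale1r.
rewrite big_seq; apply: big_ind => // z zs.
by apply: (Qz z n.+1); rewrite -pol_shift -polM /pol e2 // op0.
Qed.

Lemma eigenvalue_mem x z v : v != 0 -> br x v = z *: v -> z \in spectrum (ad x).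
Proof.
move=> v0 xv; apply: (mem_spectrumP (v := to_col v)).
  by rewrite -to_col_br xv linearZ.
by apply: contraNneq v0 => E; apply/eqP/to_col_inj; rewrite E linear0.
Qed.

Lemma mem_eigenvalue x z : z \in spectrum (ad x) ->
  exists2 v : V, v != 0 & br x v = z *: v.
Proof.
case/spectrum_eigenvector => c c0 Ec; exists (of_col c).
  by apply: contraNneq c0 => E; rewrite -[c]of_colK E linear0.
by apply: to_col_inj; rewrite to_col_br linearZ /= of_colK.
Qed.

Lemma generalized_eigenvalue_mem x z k v :
  v != 0 -> iter k (shift br x z) v = 0 -> z \in spectrum (ad x).
Proof.
elim: k v => [|k IH] v v0; first by move=> /= v0'; rewrite v0' eqxx in v0.
rewrite iterSr; case: (eqVneq (shift br x z v) 0) => [|nz]; last exact: IH.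
by move=> /eqP; rewrite subr_eq0 => /eqP /(eigenvalue_mem v0).
Qed.

Lemma spectral_operator x (phi : F -> F) :
  exists p, forall z k v, iter k (shift br x z) v = 0 -> pol x p v = phi z *: v.
Proof.
have [p Hp] := spectral_function (ad x) phi; exists p => z k v /shift_kernelE v0.
by apply: to_col_inj; rewrite to_col_op (Hp _ _ _ v0) linearZ.
Qed.

(** The generalized eigenspaces for a and b bracket into the one for a + b. If one of these three
    scalars is not an eigenvalue, the bracket vanishes, so additivity is asked only within the
    spectrum. *)
Lemma additive_spectral_derivation x phi p :
  (forall a b, a \in spectrum (ad x) -> b \in spectrum (ad x) ->
     a + b \in spectrum (ad x) -> phi (a + b) = phi a + phi b) ->
  (forall z k v, iter k (shift br x z) v = 0 -> pol x p v = phi z *: v) ->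
  forall v w, pol x p (br v w) = br (pol x p v) w + br v (pol x p w).
Proof.
move=> phiD Hp v w; elim/(@generalized_eigen_ind x) : v => [|u v IHu IHv|a i v va].
- by rewrite linear0 !(br0l Hlie) linear0 addr0.
- by rewrite linearD /= !(br_addl Hlie) linearD /= IHu IHv addrACA.
elim/(@generalized_eigen_ind x) : w => [|u w IHu IHw|b j w wb].
- by rewrite linear0 !(br0r Hlie) linear0 addr0.
- by rewrite linearD /= !(br_addr Hlie) linearD /= IHu IHw addrACA.
have vw := generalized_eigen_br Hlie va wb.
rewrite (Hp _ _ _ va) (Hp _ _ _ wb) (Hp _ _ _ vw).
rewrite (br_scalel Hlie) (br_scaler Hlie) -scalerDl.
case: (eqVneq (br v w) 0) => [->|vw0]; first by rewrite !scaler0.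
have v0 : v != 0 by apply: contraNneq vw0 => ->; rewrite br0l.
have w0 : w != 0 by apply: contraNneq vw0 => ->; rewrite br0r.
by rewrite phiD //; [exact: generalized_eigenvalue_mem v0 va
  | exact: generalized_eigenvalue_mem w0 wb
  | exact: generalized_eigenvalue_mem vw0 vw].
Qed.

(** This is the Killing form of the whole space; a subalgebra receives its restriction, not its own
    Killing form. *)
Definition killing x y : F := \tr (ad x *m ad y).

Lemma killing_sym x y : killing x y = killing y x.
Proof. exact: mxtrace_mulC. Qed.

Lemma killing_linearl y : linear_for *%R (killing^~ y).
Proof. by move=> a u v; rewrite /killing linearP /= mulmxDl -scalemxAl linearP. Qed.

Lemma killing_linearr x : linear_for *%R (killing x).
Proof. by move=> a u v; rewrite !(killing_sym x) killing_linearl. Qed.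

Lemma killing_invariant x y z : killing (br x y) z = killing x (br y z).
Proof.
rewrite /killing !ad_br mulmxBl mulmxBr !linearB /= !mulmxA; congr (_ - _).
by rewrite -(mulmxA (ad y)) [LHS]mxtrace_mulC.
Qed.
End Coordinates.

(** * Engel's theorem *)


Section Engel.
Variables (F : fieldType) (V : vectType F) (br : V -> V -> V).
Hypothesis Hlie : is_lie_bracket br.

Definition stable (L M : {vspace V}) : Prop :=
  forall x v, x \in L -> v \in M -> br x v \in M.

Lemma ex_max_subspace (P : {vspace V} -> Prop) : (exists U, P U) ->
  exists U, P U /\ forall W, P W -> (\dim W <= \dim U)%N.
Proof.
case=> U0 PU0.
have [||m [[U [PU <-]] mmax]] := @ex_max_nat
  (fun k => exists U, P U /\ \dim U = k) (\dim (fullv : {vspace V})).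
- by exists (\dim U0), U0.
- by move=> k [U [_ <-]]; rewrite dimvS // subvf.
by exists U; split=> // W PW; apply: mmax; exists W.
Qed.

Lemma mem_add_line (U : {vspace V}) y v :
  v \in (U + <[y]>)%VS -> exists2 u, u \in U & exists c : F, v = u + c *: y.
Proof.
case/memv_addP=> u uU [_ /vlineP [c ->] ->].
by exists u => //; exists c.
Qed.

Lemma dim_add_line (U : {vspace V}) y :
  y \notin U -> (\dim U < \dim (U + <[y]>))%N.
Proof.
move=> yU; rewrite ltn_neqAle dimvS ?addvSl // andbT; apply: contra yU => E.
have /eqP -> : U == (U + <[y]>)%VS by rewrite eqEdim addvSl (eqP E) leqnn.
by apply: (subvP (addvSr _ _)); rewrite memv_line.
Qed.

Lemma max_proper_absorbs (P : {vspace V} -> Prop) (K L : {vspace V}) y :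
  (forall W, P W -> (W <= L)%VS -> (\dim W < \dim L)%N -> (\dim W <= \dim K)%N) ->
  (K <= L)%VS -> y \in L -> y \notin K -> P (K + <[y]>)%VS ->
  (K + <[y]>)%VS = L.
Proof.
move=> Kmax KL yL yK PK.
have sub : (K + <[y]> <= L)%VS by rewrite subv_add KL /= -memvE.
apply/eqP; rewrite eqEdim sub leqNgt /=; apply/negP => lt.
by have := Kmax _ PK sub lt; rewrite leqNgt dim_add_line.
Qed.

(** Engel's theorem for the action of [L] on the image of [N] modulo [M], phrased without quotients.
    A maximal proper subalgebra [K] has codimension one in [L = K + <[y]>]; the vectors killed by
    [K] modulo [M] are preserved by [y], whose last iterate outside [M] is the answer. *)
Lemma engel (L M N : {vspace V}) :
  subalgebra br L -> (forall x, x \in L -> ad_nilpotent br fullv x) ->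
  stable L M -> stable L N -> ~~ (N <= M)%VS ->
  exists v, [/\ v \in N, v \notin M & forall x, x \in L -> br x v \in M].
Proof.
have [m] := ubnP (\dim L); elim: m L M N => // m IH L M N ltL subL nilL LM LN NM.
case: (eqVneq L 0%VS) => [L0|Ln0].
  have [v vN vM] := subvPn NM; exists v; split=> // x.
  by rewrite L0 memv0 => /eqP ->; rewrite (br0l Hlie) mem0v.
have [|K [[subK KL ltK] Kmax]] := @ex_max_subspace
  (fun K => [/\ subalgebra br K, (K <= L)%VS & (\dim K < \dim L)%N]).
  exists 0%VS; split; rewrite ?sub0v ?dimv0 ?lt0n ?dimv_eq0 //.
  by move=> x y; rewrite !memv0 => /eqP -> _; rewrite (br0l Hlie).
have nilK x : x \in K -> ad_nilpotent br fullv x by move/(subvP KL)/nilL.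
have ltKm : (\dim K < m)%N by apply: leq_trans ltK _; rewrite -ltnS.
have LK : ~~ (L <= K)%VS by apply: contraL ltK => /dimvS; rewrite leqNgt.
(* [K] acts on L/K, so some [y] outside [K] normalizes [K]; adjoining it gives a subalgebra, which
   must be [L]. *)
have [|y [yL yK Ky]] := IH K K L ltKm subK nilK subK _ LK.
  by move=> x v /(subvP KL); apply: subL.
have EL : (K + <[y]>)%VS = L.
  apply: (@max_proper_absorbs (subalgebra br)) => //; first by move=> W sW WL lt; apply: Kmax.
  move=> u v /mem_add_line [u' u'K [c ->]] /mem_add_line [v' v'K [c' ->]].
  rewrite (br_addl Hlie) !(br_addr Hlie) !(br_scalel Hlie) !(br_scaler Hlie).
  rewrite (br_self Hlie) !scaler0 addr0 (br_anti Hlie y v').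
  apply: (subvP (addvSl _ _)).
  apply: memvD; last by apply: memvZ; rewrite memvN Ky.
  by apply: memvD; [exact: subK | apply/memvZ/Ky].
have [||w [wN wM Kw]] := IH K M N ltKm subK nilK _ _ NM.
- by move=> x v /(subvP KL); apply: LM.
- by move=> x v /(subvP KL); apply: LN.
pose w_ j := iter j (br y) w.
have w_N j : w_ j \in N by elim: j => //= j IHj; apply: LN.
have w_K j x : x \in K -> br x (w_ j) \in M.
  elim: j x => [|j IHj] x xK; first exact: Kw.
  rewrite /w_ iterS -/(w_ j) (br_jacobi Hlie) memvD ?IHj ?Ky //.
  by apply: LM => //; apply: IHj.
have ex : exists j, w_ j \in M.
  by have [j Hj] := nilL _ yL; exists j; rewrite /w_ Hj ?memvf ?mem0v.
case: (ex_minnP ex) => [[|j] jM jmin]; first by rewrite /w_ /= (negPf wM) in jM.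
exists (w_ j); split=> //; first by apply/negP => /jmin; rewrite ltnn.
move=> x; rewrite -EL => /mem_add_line [u uK [c ->]].
rewrite (br_addl Hlie) (br_scalel Hlie).
by apply: memvD; [exact: w_K | apply: memvZ; exact: jM].
Qed.

(** Engel's theorem modulo a maximal proper ideal [M] gives [v] outside [M] with [L, v] inside [M];
    then L = M + <v>, and [L, L] lies in [M]. *)
Lemma derived_proper (L : {vspace V}) :
  subalgebra br L -> (forall x, x \in L -> ad_nilpotent br fullv x) ->
  L != 0%VS -> (\dim (derived br L) < \dim L)%N.
Proof.
move=> subL nilL L0.
have [|M [[LM ML ltM] Mmax]] := @ex_max_subspace
  (fun K => [/\ stable L K, (K <= L)%VS & (\dim K < \dim L)%N]).
  exists 0%VS; split; rewrite ?sub0v ?dimv0 ?lt0n ?dimv_eq0 //.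
  by move=> x y _; rewrite !memv0 => /eqP ->; rewrite (br0r Hlie).
have notLM : ~~ (L <= M)%VS by apply: contraL ltM => /dimvS; rewrite leqNgt.
have [v [vL vM Lv]] := engel subL nilL LM subL notLM.
have EL : (M + <[v]>)%VS = L.
  apply: (@max_proper_absorbs (stable L)) => //; first by move=> W sW WL lt; apply: Mmax.
  move=> x u xL /mem_add_line [u' u'M [c ->]].
  apply: (subvP (addvSl _ _)).
  rewrite (br_addr Hlie) (br_scaler Hlie).
  by apply: memvD; [exact: LM | apply/memvZ/Lv].
apply: leq_ltn_trans ltM; apply/dimvS; apply: derived_sub => x y xL.
rewrite -{1}EL => /mem_add_line [u uM [c ->]].
rewrite (br_addr Hlie) (br_scaler Hlie).
by apply: memvD; [exact: LM | apply/memvZ/Lv].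
Qed.

Lemma derived_subalgebra (L : {vspace V}) :
  subalgebra br L -> (derived br L <= L)%VS /\ subalgebra br (derived br L).
Proof.
move=> subL; have sub : (derived br L <= L)%VS by apply: derived_sub.
by split=> // x y /(subvP sub) xL /(subvP sub) yL; apply: (mem_derived Hlie).
Qed.

Lemma nilpotent_elements_solvable (L : {vspace V}) :
  subalgebra br L -> (forall x, x \in L -> ad_nilpotent br fullv x) ->
  solvable_sub br L.
Proof.
have [m] := ubnP (\dim L); elim: m L => // m IH L ltL subL nilL.
case: (eqVneq L 0%VS) => [->|L0]; first by exists 0%N.
have [sub subD] := derived_subalgebra subL.
have [||k Dk] := IH (derived br L) _ subD.
- exact: leq_trans (derived_proper subL nilL L0) _.
- by move=> x /(subvP sub); apply: nilL.
by exists k.+1; rewrite iterSr.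
Qed.
End Engel.

(** * Cartan's criterion and the Killing form *)


Section Subspaces.
Variables (F : fieldType) (V : vectType F).

(** A subspace of maximal dimension among those contained in [Q] absorbs every vector satisfying
    [Q]. *)
Lemma ex_subspace (Q : V -> Prop) :
  Q 0 -> (forall (a : F) u v, Q u -> Q v -> Q (a *: u + v)) ->
  exists U : {vspace V}, forall x, x \in U <-> Q x.
Proof.
move=> Q0 QL; have [|U [QU Umax]] := @ex_max_subspace _ _
  (fun U : {vspace V} => forall x, x \in U -> Q x).
  by exists 0%VS => x; rewrite memv0 => /eqP ->.
exists U => x; split=> [|Qx]; first exact: QU.
apply: contraT => xU; have := Umax (U + <[x]>)%VS; rewrite leqNgt dim_add_line //.
apply=> _ /mem_add_line [u /QU Qu [c ->]].
by rewrite addrC; apply: QL.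
Qed.

Lemma scalar_sum (lam : V -> F) (I : Type) (r : seq I) (P : pred I)
    (c : I -> F) (f : I -> V) : linear_for *%R lam ->
  lam (\sum_(i <- r | P i) c i *: f i) = \sum_(i <- r | P i) c i * lam (f i).
Proof.
move=> H; have H0 : lam 0 = 0.
  by have := H (-1) 0 0; rewrite scaler0 addr0 mulN1r addNr.
by elim/big_rec2: _ => // i y x _ <-; rewrite H.
Qed.

End Subspaces.

Section KillingForm.
Variables (F : closedFieldType) (charF0 : [pchar F] =i pred0).
Variables (V : vectType F) (br : V -> V -> V).
Hypothesis Hlie : is_lie_bracket br.
Variables (n : nat) (X : n.+1.-tuple V) (HX : basis_of fullv X).

Local Notation ad := (ad br X).
Local Notation op := (op X).
Local Notation pol := (pol br X).
Local Notation killing := (killing br X).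

Lemma ad_lin a u v : ad (a *: u + v) = a *: ad u + ad v.
Proof. exact: ad_linear. Qed.

Lemma ad0 : ad 0 = 0.
Proof. by have := ad_lin (-1) 0 0; rewrite scaler0 addr0 scaleN1r addNr. Qed.

Lemma derived_ind (I : {vspace V}) (Q : V -> Prop) :
  Q 0 -> (forall (a : F) u v, Q u -> Q v -> Q (a *: u + v)) ->
  (forall x y, x \in I -> y \in I -> Q (br x y)) ->
  forall y, y \in derived br I -> Q y.
Proof.
move=> Q0 QL Qbr; have [U UQ] := ex_subspace Q0 QL.
suff sub : (derived br I <= U)%VS by move=> y /(subvP sub) /UQ.
by apply: derived_sub => x y xI yI; apply/UQ/Qbr.
Qed.

Lemma pol_eigen x z v p : br x v = z *: v -> pol x p v = p.[z] *: v.
Proof.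
move=> xv; elim/poly_ind: p => [|p c IH].
  by rewrite /pol rmorph0 op0 // horner0 scale0r.
rewrite /pol rmorphD /= opD // horner_mx_C opC // -[op _ _]/(pol _ _ _) polM //.
rewrite {2}/pol horner_mx_X op_ad // xv linearZ /= IH scalerA -scalerDl.
by rewrite hornerMXaddC mulrC.
Qed.

Lemma derivation_commutator (D : 'M[F]_n.+1) :
  (forall v w, op D (br v w) = br (op D v) w + br v (op D w)) ->
  forall c, D *m ad c - ad c *m D = ad (op D c).
Proof.
move=> HD c; apply: (op_inj HX) => v; rewrite opB // !opM // !op_ad // HD.
by rewrite addrK.
Qed.

Lemma spectrum0_nilpotent x v :
  (forall z, z \in spectrum (ad x) -> z = 0) -> iter n.+1 (br x) v = 0.
Proof.
move=> spec0; have := Cayley_Hamilton (ad x).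
have -> : char_poly (ad x) = ('X - 0%:P) ^+ n.+1.
  rewrite char_poly_spectrum (eq_big_seq (fun=> 'X - 0%:P)) => [|z /spec0 -> //].
  by rewrite big_const_seq count_predT size_spectrum iter_mulr_1.
move=> CH; have : pol x (('X - 0%:P) ^+ n.+1) v = 0 by rewrite /pol CH op0.
rewrite pol_shift // => <-; apply: eq_iter => w.
by rewrite /shift scale0r subr0.
Qed.

Lemma orthogonal_derived_nilpotent (R : {vspace V}) x :
  subalgebra br R -> (forall a b, a \in R -> b \in R -> killing a b = 0) ->
  x \in derived br R -> ad_nilpotent br fullv x.
Proof.
move=> subR kR xD; have [sub _] := derived_subalgebra Hlie subR.
have xR : x \in R := subvP sub _ xD.
suff spec0 z : z \in spectrum (ad x) -> z = 0.
  by exists n.+1 => v _; apply: spectrum0_nilpotent.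
move: z; apply: (additive_functionals_detect_zero charF0) => phi phiD.
have [p Hp] := spectral_operator Hlie HX x phi.
have der := additive_spectral_derivation Hlie HX phiD Hp.
pose T := horner_mx (ad x) p.
have orth y : y \in derived br R -> \tr (ad y *m T) = 0.
  move: y; apply: derived_ind => [|a u v u0 v0|b c bR cR].
  - by rewrite ad0 mul0mx mxtrace0.
  - by rewrite ad_lin mulmxDl -scalemxAl linearP /= u0 v0 mulr0 addr0.
  have Tc : pol x p c \in R by apply: pol_stable => // v; apply: subR.
  have := kR _ _ bR Tc; rewrite /killing -(derivation_commutator der) => kb.
  rewrite ad_br // mulmxBl linearB /= -!mulmxA [\tr (ad c *m _)]mxtrace_mulC.
  apply/eqP; rewrite -oppr_eq0 opprB -[X in _ == X]kb mulmxBr linearB /=.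
  by rewrite !mulmxA.
have := orth _ xD; rewrite -{1}[ad x](horner_mx_X (ad x)) mulmxE -rmorphM /=.
rewrite trace_horner_mx => E; rewrite -[RHS]E; apply: eq_big_seq => z zs.
rewrite hornerM hornerX; congr (_ * _).
have [v v0 xv] := mem_eigenvalue Hlie HX zs.
have := Hp z 1%N v; rewrite (pol_eigen _ xv) /= /shift xv subrr => /(_ erefl)/eqP.
by rewrite -subr_eq0 -scalerBl scaler_eq0 (negPf v0) orbF subr_eq0 => /eqP.
Qed.

Lemma orthogonal_solvable (R : {vspace V}) :
  subalgebra br R -> (forall a b, a \in R -> b \in R -> killing a b = 0) ->
  solvable_sub br R.
Proof.
move=> subR kR; have [_ subD] := derived_subalgebra Hlie subR.
have [|k Dk] := nilpotent_elements_solvable Hlie subD.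
  by move=> x; apply: orthogonal_derived_nilpotent.
by exists k.+1; rewrite iterSr.
Qed.

(** The radical of the restricted form is an ideal of [L] on which the form vanishes, hence solvable
    by Cartan's criterion. *)
Lemma killing_nondegenerate (L : {vspace V}) : semisimple_sub br L ->
  forall x, x \in L -> (forall y, y \in L -> killing x y = 0) -> x = 0.
Proof.
move=> [subL simL].
have [||R RE] := @ex_subspace F V
  (fun x => x \in L /\ forall y, y \in L -> killing x y = 0).
- by split=> [|y _]; rewrite ?mem0v // /killing ad0 mul0mx mxtrace0.
- move=> a u v [uL u0] [vL v0]; split=> [|y yL]; first by rewrite memvD ?memvZ.
  by rewrite killing_linearl // u0 // v0 // mulr0 addr0.
have R0 : R = 0%VS.
  have idR : ideal_of br L R.
    split; first by apply/subvP => x /RE [].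
    move=> x y xL /RE [yL y0]; apply/RE; split=> [|z zL]; first exact: subL.
    rewrite br_anti // -scaleN1r -[X in killing X]addr0 killing_linearl //.
    rewrite killing_invariant // y0 ?subL // mulr0 add0r.
    by rewrite /killing ad0 mul0mx mxtrace0.
  apply: simL => //; apply: orthogonal_solvable => [x y xR yR|x y /RE [_ x0] /RE [yL _]].
    by case: idR => RL; apply=> //; apply: (subvP RL).
  exact: x0.
move=> x xL x0; have /RE : x \in L /\ forall y, y \in L -> killing x y = 0 by [].
by rewrite R0 memv0 => /eqP.
Qed.

Lemma killing_representation (L : {vspace V}) (lam : V -> F) :
  semisimple_sub br L -> linear_for *%R lam ->
  exists2 z, z \in L & forall y, y \in L -> killing z y = lam y.
Proof.
move=> simL linl; pose b := vbasis L.
have bL i : b`_i \in L.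
  case: (ltnP i (\dim L)) => [lti|gei]; last by rewrite nth_default ?mem0v // size_tuple.
  by apply: vbasis_mem; rewrite mem_nth // size_tuple.
pose G : 'M[F]_(\dim L) := \matrix_(i, j) killing b`_i b`_j.
pose comb (c : 'rV[F]_(\dim L)) := \sum_i c 0 i *: b`_i.
have combL c : comb c \in L by apply: memv_suml => i _; rewrite memvZ.
have combG c (j : 'I_(\dim L)) : killing (comb c) b`_j = (c *m G) 0 j.
  rewrite /comb (scalar_sum (lam := killing^~ b`_j)); last exact: killing_linearl.
  by rewrite mxE; apply: eq_bigr => i _; rewrite mxE.
have extend u (mu : V -> F) : linear_for *%R mu ->
    (forall i : 'I_(\dim L), killing u b`_i = mu b`_i) ->
    forall y, y \in L -> killing u y = mu y.
  move=> linm H y /coord_vbasis ->.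
  rewrite (scalar_sum _ _ _ _ linm) (scalar_sum _ _ _ _ (killing_linearr Hlie X u)).
  by apply: eq_bigr => i _; rewrite H.
have GU : G \in unitmx.
  rewrite -row_free_unit -kermx_eq0; apply/rowV0P => c /sub_kermxP cG.
  have c0 : comb c = 0.
    apply: (killing_nondegenerate simL) => //; apply: (extend _ (fun=> 0)).
      by move=> a u v; rewrite mulr0 addr0.
    by move=> i; rewrite combG cG mxE.
  apply/rowP => i; rewrite mxE.
  by have /freeP := basis_free (vbasisP L); apply; exact: c0.
pose c := (\row_i lam b`_i) *m invmx G.
exists (comb c) => //; apply: extend => // i.
by rewrite combG mulmxKV // mxE.
Qed.

(** Let z represent the functional y -> tr(D ad y). Then D' = D - ad z is trace-orthogonal to all ad
    y, and killing (D' v) y = tr(D' ad [v,y]) = 0, so D' = 0 by nondegeneracy. *)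
Lemma derivation_inner (D : 'M[F]_n.+1) : semisimple_sub br fullv ->
  (forall v w, op D (br v w) = br (op D v) w + br v (op D w)) ->
  exists s, D = ad s.
Proof.
move=> simV HD.
have [|z _ Hz] := @killing_representation fullv (fun y => \tr (D *m ad y)) simV.
  by move=> a u v; rewrite ad_lin mulmxDr -scalemxAr linearP.
exists z; apply/eqP; rewrite -subr_eq0; apply/eqP; set D' := D - ad z.
have trD' y : \tr (D' *m ad y) = 0.
  by rewrite mulmxBl linearB /= -Hz ?memvf ?subrr.
have HD' v w : op D' (br v w) = br (op D' v) w + br v (op D' w).
  rewrite !opB // HD !op_ad // (br_subl Hlie) (br_subr Hlie).
  by rewrite (br_jacobi Hlie z) opprD addrACA.
apply: (op_inj HX) => v; rewrite op0 //.
apply: (killing_nondegenerate simV); rewrite ?memvf // => y _.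
rewrite /killing -(derivation_commutator HD') mulmxBl linearB /=.
rewrite -mulmxA -[ad v *m D' *m _]mulmxA [X in _ - X]mxtrace_mulC -mulmxA.
by rewrite -linearB /= -mulmxBr -ad_br // trD'.
Qed.

(** The identity function is additive, so the semisimple part of ad x is a derivation and therefore
    inner. *)
Lemma semisimple_part x : semisimple_sub br fullv ->
  exists s, forall z k v, iter k (shift br x z) v = 0 -> br s v = z *: v.
Proof.
move=> simV; have [p Hp] := spectral_operator Hlie HX x id.
have [//|s Es] := @derivation_inner (horner_mx (ad x) p) simV.
  exact: (additive_spectral_derivation Hlie HX (phi := id) _ Hp).
by exists s => z k v /Hp; rewrite /pol Es op_ad.
Qed.

(** [y'] represents the functional [killing y] on [q]. The remainder is orthogonal to [q] and
    normalizes it; by invariance its bracket with [q] lies in [q] and is orthogonal to [q], hence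
    zero. *)
Lemma normalizer_decomposition (q : {vspace V}) y : semisimple_sub br q ->
  (forall a, a \in q -> br y a \in q) ->
  exists2 y', y' \in q & forall a, a \in q ->
    killing (y - y') a = 0 /\ br (y - y') a = 0.
Proof.
move=> simq yq.
have [|y' y'q Hy'] := @killing_representation q (killing y) simq.
  exact: killing_linearr.
exists y' => // a aq; have k0 b : b \in q -> killing (y - y') b = 0.
  move=> bq; rewrite addrC -scaleN1r killing_linearl // mulN1r Hy' //.
  by rewrite addNr.
split; first exact: k0.
have [subq _] := simq.
apply: (killing_nondegenerate simq).
  by rewrite (br_subl Hlie) memvB ?yq ?subq.
by move=> b bq; rewrite killing_invariant // k0 // subq.
Qed.
End KillingForm.

(** * sl2-triples *)


Section Sl2.
Variables (F : closedFieldType) (charF0 : [pchar F] =i pred0).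
Variables (V : vectType F) (br : V -> V -> V).
Hypothesis Hlie : is_lie_bracket br.
Variables (n : nat) (X : n.+1.-tuple V) (HX : basis_of fullv X).

Lemma mem_grade (L : {vspace V}) h (j : int) v :
  v \in grade br L h j <-> v \in L /\ br h v = j%:~R *: v.
Proof.
pose g : {linear V -> V} := HB.pack (shift br h j%:~R)
  (GRing.isLinear.Build F V V *:%R (shift br h j%:~R) (shift_linear Hlie h j%:~R)).
rewrite /grade memv_cap -[linfun _]/(linfun g) memv_ker lfunE /= /shift subr_eq0.
by split=> [/andP [-> /eqP]|[-> ->]]; rewrite ?eqxx.
Qed.

Lemma natr_eq0_char0 m : (m%:R == 0 :> F) = (m == 0%N).
Proof. exact: (pcharf0P F).1. Qed.

Lemma natr_inj_char0 (i j : nat) : i%:R = j%:R :> F -> i = j.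
Proof.
wlog ij : i j / (i <= j)%N => [H E|].
  by case: (leqP i j) => [/H|/ltnW /H /(_ (esym E))] ->.
move/eqP; rewrite eq_sym -subr_eq0 -natrB // natr_eq0_char0 subn_eq0 => ji.
by apply/eqP; rewrite eqn_leq ij.
Qed.

Lemma weight_br h y m w c :
  br h y = m *: y -> br h w = c *: w -> br h (br y w) = (m + c) *: br y w.
Proof.
move=> hy hw; rewrite (br_jacobi Hlie) hy hw (br_scalel Hlie) (br_scaler Hlie).
by rewrite scalerDl.
Qed.

Lemma weight_iter h y m w c k : br h y = m *: y -> br h w = c *: w ->
  br h (iter k (br y) w) = (c + m *+ k) *: iter k (br y) w.
Proof.
move=> hy hw; elim: k => [|k IH]; first by rewrite mulr0n addr0.
by rewrite iterS (weight_br hy IH) mulrS addrCA.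
Qed.

(** Nonzero iterates have the pairwise distinct weights c + m k; n + 2 of them would exceed the
    number of eigenvalues of ad h. *)
Lemma weight_iter_vanishes h y m w c : m != 0 ->
  br h y = m *: y -> br h w = c *: w -> w != 0 ->
  exists2 k, iter k (br y) w != 0 & iter k.+1 (br y) w = 0.
Proof.
move=> m0 hy hw w0.
have ex : exists j, iter j (br y) w == 0.
  case: (boolP (has (fun j => iter j (br y) w == 0) (iota 0 n.+2))).
    by case/hasP => j _ Hj; exists j.
  move/hasPn => nz; pose s := [seq c + m *+ j | j <- iota 0 n.+2].
  have us : uniq s.
    rewrite map_inj_uniq ?iota_uniq // => i j /addrI.
    by rewrite -[m *+ i]mulr_natr -[m *+ j]mulr_natr => /(mulfI m0) /natr_inj_char0.
  have sub : {subset s <= spectrum (ad br X h)}.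
    move=> _ /mapP [j js ->]; apply: (eigenvalue_mem Hlie HX (nz _ js)).
    exact: weight_iter.
  have := uniq_leq_size us sub.
  by rewrite size_map size_iota size_spectrum ltnn.
case: (ex_minnP ex) => [[|k] /eqP k0 kmin]; first by rewrite /= in k0; rewrite k0 eqxx in w0.
exists k => //; apply/negP => /kmin; by rewrite ltnn.
Qed.

Lemma sl2_triple_opp e h f : sl2_triple br e h f -> sl2_triple br f (- h) e.
Proof.
case=> he hf ef; split; rewrite ?(br_oppl Hlie) ?he ?hf ?opprK //.
by rewrite (br_anti Hlie) ef.
Qed.

Section Triple.
Variables (e h f : V) (Hs : sl2_triple br e h f).

Lemma br_h_e : br h e = 2%:R *: e. Proof. by case: Hs. Qed.
Lemma br_h_f : br h f = (- 2%:R) *: f. Proof. by case: Hs => _ ->; rewrite scaleNr. Qed.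
Lemma br_e_f : br e f = h. Proof. by case: Hs. Qed.

Lemma raise_lowered w a k : br e w = 0 -> br h w = a *: w ->
  br e (iter k.+1 (br f) w) = (k.+1%:R * (a - k%:R)) *: iter k (br f) w.
Proof.
move=> ew hw; elim: k => [|k IH].
  by rewrite /= (br_jacobi Hlie) br_e_f hw ew (br0r Hlie) addr0 mul1r subr0.
rewrite iterS (br_jacobi Hlie) br_e_f (weight_iter k.+1 br_h_f hw) IH.
rewrite (br_scaler Hlie) -iterS -scalerDl; congr (_ *: _).
by rewrite -!natr1 -mulr_natr -!natr1; ring.
Qed.

(** For the last nonzero f^k w, applying e to f^(k+1) w = 0 forces (k + 1)(a - k) = 0. *)
Lemma highest_weight w a : w != 0 -> br e w = 0 -> br h w = a *: w ->
  exists2 k, a = k%:R & iter k (br f) w != 0.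
Proof.
move=> w0 ew hw.
have m0 : - 2%:R != 0 :> F by rewrite oppr_eq0 natr_eq0_char0.
have [k fk fk1] := weight_iter_vanishes m0 br_h_f hw w0.
exists k => //; have := raise_lowered k ew hw.
rewrite fk1 (br0r Hlie) => /esym/eqP.
rewrite scaler_eq0 (negPf fk) orbF mulf_eq0 natr_eq0_char0 /= subr_eq0.
by move/eqP.
Qed.

Lemma highest_vector v c : v != 0 -> br h v = c *: v ->
  exists k, [/\ iter k (br e) v != 0, br e (iter k (br e) v) = 0
              & br h (iter k (br e) v) = (c + 2%:R *+ k) *: iter k (br e) v].
Proof.
move=> v0 hv; have m0 : 2%:R != 0 :> F by rewrite natr_eq0_char0.
have [k ek ek1] := weight_iter_vanishes m0 br_h_e hv v0.
by exists k; split=> //; apply: weight_iter => //; apply: br_h_e.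
Qed.

Lemma integral_weight v c : v != 0 -> br h v = c *: v -> exists j : int, c = j%:~R.
Proof.
move=> v0 hv; have [k [w0 ew hw]] := highest_vector v0 hv.
have [l El _] := highest_weight w0 ew hw.
exists (l%:Z - (2 * k)%:Z); rewrite rmorphB /= -!pmulrn -El natrM mulr_natr.
by rewrite addrK.
Qed.

End Triple.

(** Lowering [v] as far as possible reaches a vector of weight -k killed by f, with k = j + 2a; its
    image under e^k is nonzero of weight k. The bound j <= k suffices because the depth bounds k
    from above. *)
Lemma reversed_weight e h f (L : {vspace V}) v (j : nat) :
  sl2_triple br e h f ->
  (forall x, x \in L -> br e x \in L) -> (forall x, x \in L -> br f x \in L) ->
  v \in L -> v != 0 -> br h v = (- j%:R) *: v ->
  exists k u, [/\ (j <= k)%N, u \in L, u != 0 & br h u = k%:R *: u].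
Proof.
move=> Hs eL fL vL v0 hv; have Ht := sl2_triple_opp Hs.
have [|a [w0 fw hw]] := highest_vector Ht (c := j%:R) v0.
  by rewrite (br_oppl Hlie) hv scaleNr opprK.
have [k Ek ek] := highest_weight Ht w0 fw hw.
have iterL (y : V) i w : (forall x, x \in L -> br y x \in L) -> w \in L ->
    iter i (br y) w \in L.
  by move=> yL wL; elim: i => //= i IH; apply: yL.
have kE : k = (j + 2 * a)%N by apply: natr_inj_char0; rewrite -Ek natrD natrM mulr_natr.
exists k, (iter k (br e) (iter a (br f) v)); split=> //.
- by rewrite kE leq_addr.
- by apply: (iterL _) => //; apply: (iterL _).
have hw' : br h (iter a (br f) v) = (- k%:R) *: iter a (br f) v.
  by rewrite scaleNr -Ek -hw (br_oppl Hlie) opprK.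
rewrite (weight_iter k (br_h_e Hs) hw'); congr (_ *: _).
by rewrite -mulr_natl; ring.
Qed.

End Sl2.

(** * Exponentials of nilpotent derivations *)


Lemma triangular_sum (V : nmodType) (g : nat -> nat -> V) (K : nat) :
  \sum_(k < K) \sum_(i < k.+1) g i (k - i)%N = \sum_(i < K) \sum_(j < K - i) g i j.
Proof.
elim: K => [|K IH]; first by rewrite !big_ord0.
rewrite big_ord_recr /= IH.
transitivity (\sum_(i < K.+1) (\sum_(j < K - i) g i j + g i (K - i)%N)).
  rewrite big_split /=; congr (_ + _).
  by rewrite big_ord_recr /= subnn big_ord0 addr0.
by apply: eq_bigr => i _; rewrite subSn ?leq_ord // big_ord_recr.
Qed.

(** Cauchy product of two sums of length M: the diagonals up to M + M cover the square, and all
    other terms vanish. *)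
Lemma square_sum (V : nmodType) (g : nat -> nat -> V) (M : nat) :
  (forall i j, (M <= i)%N || (M <= j)%N -> g i j = 0) ->
  \sum_(k < M + M) \sum_(i < k.+1) g i (k - i)%N = \sum_(i < M) \sum_(j < M) g i j.
Proof.
move=> g0; rewrite triangular_sum big_split_ord /= [X in _ + X]big1 ?addr0; last first.
  by move=> i _; rewrite big1 // => j _; rewrite g0 // leq_addr.
apply: eq_bigr => i _; have -> : (M + M - i = M + (M - i))%N by rewrite addnBA // ltnW.
rewrite big_split_ord /= [X in _ + X]big1 ?addr0 // => j _.
by rewrite g0 // leq_addr orbT.
Qed.

Section InnerAutomorphisms.
Variables (F : closedFieldType) (charF0 : [pchar F] =i pred0).
Variables (V : vectType F) (br : V -> V -> V).
Hypothesis Hlie : is_lie_bracket br.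

Definition lie_automorphism (phi : V -> V) : Prop :=
  [/\ linear phi, injective phi & forall v w, phi (br v w) = br (phi v) (phi w)].

Definition divided_ad x k v : V := (k`!%:R)^-1 *: iter k (br x) v.

Lemma divided_ad_succ x k v :
  br x (divided_ad x k v) = k.+1%:R *: divided_ad x k.+1 v.
Proof.
rewrite /divided_ad (br_scaler Hlie) scalerA factS natrM invfM mulrA divff ?mul1r //.
by rewrite (pcharf0P F).1.
Qed.

Lemma divided_ad_br x k v w :
  divided_ad x k (br v w) =
  \sum_(i < k.+1) br (divided_ad x i v) (divided_ad x (k - i) w).
Proof.
elim: k => [|k IH].
  by rewrite big_ord1 /divided_ad /= fact0 invr1 !scale1r.
have k0 : k.+1%:R != 0 :> F by rewrite (pcharf0P F).1.
apply: (scalerI k0); rewrite -divided_ad_succ IH (br_sumr Hlie).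
pose G i := br (divided_ad x i v) (divided_ad x (k.+1 - i) w).
(* The factor k + 1 is split as i + (k + 1 - i); after a shift of index the two halves are the two
   terms of the Leibniz rule. *)
transitivity (\sum_(i < k.+2) i%:R *: G i + \sum_(i < k.+2) (k.+1 - i)%:R *: G i).
  rewrite [X in _ = X + _]big_ord_recl [X in _ = _ + X]big_ord_recr /=.
  rewrite subnn !scale0r add0r addr0 -big_split /=; apply: eq_bigr => i _.
  rewrite (br_jacobi Hlie) !divided_ad_succ (br_scalel Hlie).
  by rewrite (br_scaler Hlie (k - i).+1%:R) /G /bump /= add1n subSS subSn ?leq_ord.
rewrite -big_split /= scaler_sumr; apply: eq_bigr => i _.
by rewrite -scalerDl -natrD subnKC // leq_ord.
Qed.

Lemma iter_br_linear x k : linear (iter k (br x)).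
Proof.
by elim: k => [|k IH] a u v //=; rewrite IH (br_addr Hlie) (br_scaler Hlie).
Qed.

Lemma iter_br0 x k : iter k (br x) 0 = 0.
Proof. by elim: k => //= k ->; rewrite (br0r Hlie). Qed.

Lemma iter_br_scale x k a v : iter k (br x) (a *: v) = a *: iter k (br x) v.
Proof. by have := iter_br_linear x k a v 0; rewrite iter_br0 !addr0. Qed.

Lemma divided_ad_linear x k : linear (divided_ad x k).
Proof.
by move=> a u v; rewrite /divided_ad iter_br_linear scalerDr !scalerA mulrC.
Qed.

Lemma exp_ad_linear x : linear (exp_ad br x).
Proof.
move=> a u v; rewrite /exp_ad scaler_sumr -big_split /=.
by apply: eq_bigr => k _; rewrite -!/(divided_ad _ _ _) divided_ad_linear.
Qed.

Variables (n : nat) (X : n.+1.-tuple V) (HX : basis_of fullv X).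

Lemma ad_nilpotent_spectrum x : ad_nilpotent br fullv x ->
  forall z, z \in spectrum (ad br X x) -> z = 0.
Proof.
case=> k xk z /(mem_eigenvalue Hlie HX) [v v0 xv].
have : iter k (br x) v = z ^+ k *: v.
  elim: (k) => [|i IH]; first by rewrite scale1r.
  by rewrite iterS IH (br_scaler Hlie) xv scalerA exprSr.
rewrite xk ?memvf // => /esym/eqP; rewrite scaler_eq0 (negPf v0) orbF.
by rewrite expf_eq0 => /andP [_ /eqP].
Qed.

(** Nilpotence allows any exponent; Cayley-Hamilton brings it down to the dimension, so the
    truncated exponential is the full series. *)
Lemma iter_ad_nilpotent x k v : ad_nilpotent br fullv x ->
  (\dim (fullv : {vspace V}) <= k)%N -> iter k (br x) v = 0.
Proof.
have -> : \dim (fullv : {vspace V}) = n.+1 by rewrite -(vector.size_basis HX).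
move=> /ad_nilpotent_spectrum spec0 lek.
have /subnK <- := lek; rewrite iterD.
rewrite (spectrum0_nilpotent Hlie HX v spec0).
exact: iter_br0.
Qed.

Lemma exp_ad_automorphism x : ad_nilpotent br fullv x ->
  lie_automorphism (exp_ad br x).
Proof.
move=> xnil; set M := (\dim (fullv : {vspace V})).+1.
have div0 k v : (M <= k)%N -> divided_ad x k v = 0.
  by move=> /ltnW lek; rewrite /divided_ad iter_ad_nilpotent ?scaler0.
have expE v : exp_ad br x v = \sum_(k < M) divided_ad x k v by [].
split; first exact: exp_ad_linear.
  suff inj0 v : exp_ad br x v = 0 -> v = 0.
    move=> u v uv; apply/eqP; rewrite -subr_eq0; apply/eqP/inj0.
    by rewrite addrC -scaleN1r exp_ad_linear uv scaleN1r addNr.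
  move=> ev; apply/eqP; apply: contraT => v0.
  have ex : exists k, iter k (br x) v == 0.
    by exists M; rewrite iter_ad_nilpotent.
  case: (ex_minnP ex) => [[|k] /eqP vk kmin]; first by rewrite /= in vk; rewrite vk eqxx in v0.
  (* As k + 1 is the least exponent killing [v], (ad x)^k removes all terms of the exponential but
     the constant one. *)
  have : iter k (br x) (exp_ad br x v) = iter k (br x) v.
    pose g : {linear V -> V} := HB.pack (iter k (br x))
      (GRing.isLinear.Build F V V *:%R (iter k (br x)) (iter_br_linear x k)).
    rewrite expE -[iter k (br x)]/(g : V -> V) linear_sum big_ord_recl /= big1 ?addr0.
      by rewrite /divided_ad fact0 invr1 scale1r.
    move=> i _; rewrite /divided_ad iter_br_scale -iterD /bump add1n addnS -addSn addnC iterD vk.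
    by rewrite iter_br0 scaler0.
  rewrite ev iter_br0 => /esym.
  by move/eqP => /kmin; rewrite ltnn.
move=> v w; rewrite !expE.
transitivity (\sum_(k < M + M) divided_ad x k (br v w)).
  rewrite big_split_ord /= [X in _ = _ + X]big1 ?addr0 // => i _.
  by rewrite div0 // leq_addr.
under eq_bigr do rewrite divided_ad_br.
rewrite (square_sum (g := fun i j => br (divided_ad x i v) (divided_ad x j w))).
  rewrite (br_suml Hlie); apply: eq_bigr => i _.
  by rewrite (br_sumr Hlie).
by move=> i j /orP [/div0 ->|/div0 ->]; rewrite ?(br0l Hlie) ?(br0r Hlie).
Qed.

Lemma inner_aut_automorphism phi : inner_aut br phi -> lie_automorphism phi.
Proof.
elim=> [x|f g _ [lf injf mf] _ [lg injg mg]]; first exact: exp_ad_automorphism.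
split=> [a u v|u v /injf /injg //|u v] /=; first by rewrite lg lf.
by rewrite mg mf.
Qed.
End InnerAutomorphisms.

(** * Polynomial functions and Zariski closed sets *)


(** Arbitrary [L] and [R] replace the selection of rows and columns of a minor; each choice yields a
    polynomial function of [M]. *)
Lemma rank_geP (F : fieldType) (a b m : nat) (M : 'M[F]_(a, b)) :
  (m <= \rank M)%N <->
  exists (L : 'M_(m, a)) (R : 'M_(b, m)), \det (L *m M *m R) != 0.
Proof.
split=> [le_m|[L [R]]].
  exists (pid_mx m *m invmx (col_ebase M)), (invmx (row_ebase M) *m pid_mx m).
  have ma := leq_trans le_m (rank_leq_row M).
  have mb := leq_trans le_m (rank_leq_col M).
  have -> : pid_mx m *m invmx (col_ebase M) *m M *m (invmx (row_ebase M) *m pid_mx m)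
     = 1%:M :> 'M_m.
    rewrite -[M in _ *m M *m _]mulmx_ebase !mulmxA mulmxKV ?col_ebase_unit //.
    rewrite mulmxK ?row_ebase_unit // !mul_pid_mx -pid_mx_1; congr (pid_mx _).
    by rewrite (minn_idPl le_m) (minn_idPr ma) minnn (minn_idPr mb).
  by rewrite det1 oner_neq0.
rewrite -unitfE -[_ \is a GRing.unit]/(_ \in unitmx) => /mxrank_unit <-.
exact: leq_trans (mxrankM_maxl _ _) (mxrankM_maxr _ _).
Qed.

Section Zariski.
Variables (F : closedFieldType) (V : vectType F).
Implicit Types (W : {vspace V}) (g : V -> F).

Definition polynomial_on W g : Prop :=
  exists p : mpoly.mpoly (\dim W) F,
    forall v, v \in W -> g v = mpoly.meval (@coords F V W v) p.

Lemma polynomial_on_ext W g g' :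
  (forall v, v \in W -> g v = g' v) -> polynomial_on W g -> polynomial_on W g'.
Proof. by move=> E [p Hp]; exists p => v vW; rewrite -E // Hp. Qed.

Lemma polynomial_on_const W c : polynomial_on W (fun=> c).
Proof. by exists (mpolyC _ c) => v _; rewrite mevalC. Qed.

Lemma polynomial_on_add W g g' : polynomial_on W g -> polynomial_on W g' ->
  polynomial_on W (fun v => g v + g' v).
Proof.
by case=> p Hp [p' Hp']; exists (p + p') => v vW; rewrite mevalD Hp // Hp'.
Qed.

Lemma polynomial_on_mul W g g' : polynomial_on W g -> polynomial_on W g' ->
  polynomial_on W (fun v => g v * g' v).
Proof.
by case=> p Hp [p' Hp']; exists (p * p') => v vW; rewrite mevalM Hp // Hp'.
Qed.

Lemma polynomial_on_sum W (I : Type) (r : seq I) (P : pred I) (G : I -> V -> F) :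
  (forall i, polynomial_on W (G i)) ->
  polynomial_on W (fun v => \sum_(i <- r | P i) G i v).
Proof.
move=> HG; elim: r => [|i r IH].
  by apply: polynomial_on_ext (polynomial_on_const W 0) => v _; rewrite big_nil.
case Pi : (P i).
  by apply: polynomial_on_ext (polynomial_on_add (HG i) IH) => v _; rewrite big_cons Pi.
by apply: polynomial_on_ext IH => v _; rewrite big_cons Pi.
Qed.

Lemma polynomial_on_prod W (I : Type) (r : seq I) (P : pred I) (G : I -> V -> F) :
  (forall i, polynomial_on W (G i)) ->
  polynomial_on W (fun v => \prod_(i <- r | P i) G i v).
Proof.
move=> HG; elim: r => [|i r IH].
  by apply: polynomial_on_ext (polynomial_on_const W 1) => v _; rewrite big_nil.
case Pi : (P i).
  by apply: polynomial_on_ext (polynomial_on_mul (HG i) IH) => v _; rewrite big_cons Pi.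
by apply: polynomial_on_ext IH => v _; rewrite big_cons Pi.
Qed.

Lemma polynomial_on_coord W i : polynomial_on W (coord (vbasis W) i).
Proof. by exists 'X_i => v _; rewrite mevalXU. Qed.

Lemma polynomial_on_linear W g : linear_for *%R g -> polynomial_on W g.
Proof.
move=> ling.
apply: (@polynomial_on_ext W (fun v => \sum_(i < \dim W) g (vbasis W)`_i * coord (vbasis W) i v : F) g).
  move=> v vW; rewrite [in RHS](coord_vbasis vW) (scalar_sum _ _ _ _ ling).
  by apply: eq_bigr => i _; rewrite mulrC.
apply: polynomial_on_sum => i; apply: polynomial_on_mul; first exact: polynomial_on_const.
exact: polynomial_on_coord.
Qed.

Lemma polynomial_on_comp W W' g (phi : V -> V) :
  linear phi -> (forall v, v \in W -> phi v \in W') ->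
  polynomial_on W' g -> polynomial_on W (g \o phi).
Proof.
move=> linphi phiW [p Hp].
apply: (@polynomial_on_ext W (fun v => \sum_(m <- msupp p)
   mcoeff m p * \prod_i coord (vbasis W') i (phi v) ^+ m i)).
  by move=> v vW /=; rewrite Hp ?phiW // mevalE.
apply: polynomial_on_sum => m; apply: polynomial_on_mul; first exact: polynomial_on_const.
apply: polynomial_on_prod => i.
have lin : polynomial_on W (fun v => coord (vbasis W') i (phi v)).
  by apply: polynomial_on_linear => a u v; rewrite linphi linearP.
elim: (m i) => [|k IH]; first by apply: polynomial_on_const.
by apply: polynomial_on_ext (polynomial_on_mul lin IH) => v _; rewrite exprS.
Qed.

Definition polynomial_mx W (a b : nat) (M : V -> 'M[F]_(a, b)) : Prop :=
  forall i j, polynomial_on W (fun v => M v i j).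

Lemma polynomial_mx_const W a b (A : 'M[F]_(a, b)) : polynomial_mx W (fun=> A).
Proof. by move=> i j; apply: polynomial_on_const. Qed.

Lemma polynomial_mx_mul W a b c (M : V -> 'M[F]_(a, b)) (N : V -> 'M[F]_(b, c)) :
  polynomial_mx W M -> polynomial_mx W N -> polynomial_mx W (fun v => M v *m N v).
Proof.
move=> HM HN i j; apply: (@polynomial_on_ext W (fun v => \sum_k M v i k * N v k j)).
  by move=> v _; rewrite mxE.
by apply: polynomial_on_sum => k; apply: polynomial_on_mul.
Qed.

Lemma polynomial_mx_exp W a (M : V -> 'M[F]_a.+1) k :
  polynomial_mx W M -> polynomial_mx W (fun v => M v ^+ k).
Proof.
move=> HM; elim: k => [|k IH]; first exact: polynomial_mx_const.
move=> i j; apply: polynomial_on_ext (polynomial_mx_mul HM IH i j) => v _.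
by rewrite exprS.
Qed.

Lemma polynomial_on_det W a (M : V -> 'M[F]_a) :
  polynomial_mx W M -> polynomial_on W (fun v => \det (M v)).
Proof.
move=> HM; apply: polynomial_on_sum => s; apply: polynomial_on_mul.
  exact: polynomial_on_const.
by apply: polynomial_on_prod => i; apply: HM.
Qed.

Lemma zclosed_family W (Q : (V -> F) -> Prop) (C : V -> Prop) :
  (forall g, Q g -> polynomial_on W g) ->
  (forall v, C v <-> v \in W /\ forall g, Q g -> g v = 0) -> zclosed W C.
Proof.
move=> polyQ HC.
exists (fun p => exists2 g, Q g & forall v, v \in W -> g v = mpoly.meval (@coords F V W v) p).
move=> v; split=> [/HC [vW v0]|[vW v0]].
  by split=> // p [g Qg E]; rewrite -E // v0.
apply/HC; split=> // g Qg; have [p Hp] := polyQ g Qg.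
by rewrite Hp // v0 //; exists g.
Qed.

Lemma zclosedP W (C : V -> Prop) : zclosed W C ->
  exists2 Q : (V -> F) -> Prop, (forall g, Q g -> polynomial_on W g)
    & forall v, C v <-> v \in W /\ forall g, Q g -> g v = 0.
Proof.
case=> P HP; exists (fun g => exists2 p, P p & g = fun v => mpoly.meval (@coords F V W v) p).
  by move=> _ [p _ ->]; exists p.
move=> v; split=> [/HP [vW v0]|[vW v0]].
  by split=> // _ [p Pp ->]; apply: v0.
by apply/HP; split=> // p Pp; apply: (v0 (fun v => mpoly.meval (@coords F V W v) p)); exists p.
Qed.

Lemma zclosed_rank W a b (M : V -> 'M[F]_(a, b)) (m : nat) (C : V -> Prop) :
  polynomial_mx W M -> (forall v, C v <-> v \in W /\ ~ (m <= \rank (M v))%N) ->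
  zclosed W C.
Proof.
move=> HM HC; apply: (@zclosed_family W (fun g =>
  exists (L : 'M_(m, a)) (R : 'M_(b, m)), g = fun v => \det (L *m M v *m R))).
  move=> _ [L [R ->]]; apply: polynomial_on_det.
  apply: polynomial_mx_mul; last exact: polynomial_mx_const.
  by apply: polynomial_mx_mul => //; apply: polynomial_mx_const.
move=> v; split=> [/HC [vW lt]|[vW v0]].
  split=> // _ [L [R ->]]; apply/eqP; apply: contraT => nz.
  by case: lt; apply/rank_geP; exists L, R.
apply/HC; split=> // /rank_geP [L [R]].
by rewrite (v0 (fun v => \det (L *m M v *m R))) ?eqxx //; exists L, R.
Qed.

Lemma polynomial_on_line W g u w : polynomial_on W g -> u \in W -> w \in W ->
  exists p : {poly F}, forall t, g (u + t *: w) = p.[t].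
Proof.
case=> p Hp uW wW.
exists (\sum_(m <- msupp p) (mcoeff m p)%:P *
  \prod_i ((coord (vbasis W) i u)%:P + (coord (vbasis W) i w)%:P * 'X) ^+ m i).
move=> t; rewrite Hp ?memvD ?memvZ // mevalE horner_sum.
apply: eq_bigr => m _; rewrite hornerM hornerC horner_prod; congr (_ * _).
apply: eq_bigr => i _; rewrite horner_exp hornerD hornerM !hornerC hornerX.
by rewrite /coords linearD linearZ /= mulrC.
Qed.

(* Restricting to a line through a point of U reduces the irreducibility of W
   to the integrality of the ring of polynomials in one variable. *)
Lemma polynomial_vanishing_on_open W (U : V -> Prop) u0 g :
  zopen W U -> U u0 -> polynomial_on W g -> (forall v, U v -> g v = 0) ->
  forall v, v \in W -> g v = 0.
Proof.
move=> [UW /zclosedP [Q polyQ HQ]] Uu0 polyg g0 v vW.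
have u0W := UW _ Uu0.
have [g1 Qg1 g1u0] : exists2 g1, Q g1 & g1 u0 != 0.
  apply: NNPP => H; have [_ nU] : u0 \in W /\ ~ U u0; last exact: nU.
  apply: (HQ u0).2; split=> // g1 Qg1.
  by apply/eqP; apply: contraT => nz; case: H; exists g1.
have vuW : v - u0 \in W by rewrite memvB.
have [p Hp] := polynomial_on_line polyg u0W vuW.
have [p1 Hp1] := polynomial_on_line (polyQ _ Qg1) u0W vuW.
(* At a parameter where [p] does not vanish the point lies outside [U], and there [g1] vanishes. *)
have /eqP : p * p1 = 0.
  apply/eqP; apply: contraT => /closed_nonrootP [t]; rewrite rootE hornerM -Hp -Hp1.
  rewrite mulf_eq0 negb_or => /andP [gt g1t].
  have tW : u0 + t *: (v - u0) \in W by rewrite memvD ?memvZ.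
  have nU : ~ U (u0 + t *: (v - u0)) by move=> /g0 E; rewrite E eqxx in gt.
  have [_ /(_ _ Qg1) E] := (HQ (u0 + t *: (v - u0))).1 (conj tW nU).
  by rewrite E eqxx in g1t.
rewrite mulf_eq0 => /orP [] /eqP p0.
  by have := Hp 1; rewrite scale1r addrC subrK p0 horner0.
by have := Hp1 0; rewrite scale0r addr0 p0 horner0 => E; rewrite E eqxx in g1u0.
Qed.

End Zariski.

(** * Semisimple elements *)


Lemma span_kernel_ind (F : fieldType) (V : vectType F) (s : seq V) (g : V -> V) :
  linear g -> (forall v, v \in s -> g v = 0) -> forall v, v \in <<s>>%VS -> g v = 0.
Proof.
move=> ling gs; have g0 : g 0 = 0.
  by have := ling (-1) 0 0; rewrite scaler0 addr0 scaleN1r addNr.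
have [||U UE] := @ex_subspace F V (fun v => g v = 0) => //.
  by move=> a u v u0 v0; rewrite ling u0 v0 scaler0 addr0.
suff sub : (<<s>> <= U)%VS by move=> v /(subvP sub) /UE.
by apply/span_subvP => v /gs v0; apply/UE.
Qed.

Section SemisimpleElements.
Variables (F : closedFieldType) (charF0 : [pchar F] =i pred0).
Variables (V : vectType F) (br : V -> V -> V).
Hypothesis Hlie : is_lie_bracket br.
Variables (n : nat) (X : n.+1.-tuple V) (HX : basis_of fullv X).

Local Notation ad := (ad br X).
Local Notation op := (op X).
Local Notation pol := (pol br X).

Lemma pol_linear x p : linear (pol x p).
Proof. exact: op_linear. Qed.

Lemma pol_radical_eigen x z v :
  br x v = z *: v -> pol x (radical (ad x)) v = 0.
Proof.
move=> xv; rewrite (pol_eigen Hlie HX _ xv).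
case: (eqVneq v 0) => [->|v0]; first by rewrite scaler0.
have /eqP -> : root (radical (ad x)) z.
  by rewrite root_radical (eigenvalue_mem Hlie HX v0 xv).
by rewrite scale0r.
Qed.

Lemma ad_semisimple_radical x : ad_semisimple br fullv x ->
  horner_mx (ad x) (radical (ad x)) = 0.
Proof.
case=> s [_ sV eig]; apply: (op_inj HX) => v; rewrite op0 //.
apply: (span_kernel_ind (g := pol x (radical (ad x))) (s := s)).
- exact: pol_linear.
- by move=> w /eig [c xw]; apply: pol_radical_eigen xw.
by rewrite sV memvf.
Qed.

Lemma eigen_decomposition x s : uniq s ->
  horner_mx (ad x) (\prod_(z <- s) ('X - z%:P)) = 0 ->
  exists e : F -> {poly F}, (forall v, v = \sum_(z <- s) pol x (e z) v) /\
    forall z v, z \in s -> br x (pol x (e z) v) = z *: pol x (e z) v.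
Proof.
move=> us D0; have [|e [e1 e2]] := @annihilator_decomposition F n (ad x) s 1 us.
  by under eq_bigr do rewrite expr1.
exists e; split=> [v|z v zs]; first by rewrite -op_sum // e1 opC // scale1r.
apply/eqP; rewrite -subr_eq0 -[X in X == 0]/(iter 1 (shift br x z) _).
by rewrite -(pol_shift Hlie HX) -polM // /pol e2 // op0.
Qed.

Lemma annihilator_ad_semisimple x s (L : {vspace V}) : uniq s ->
  (forall v, v \in L -> br x v \in L) ->
  horner_mx (ad x) (\prod_(z <- s) ('X - z%:P)) = 0 -> ad_semisimple br L x.
Proof.
move=> us xL /(eigen_decomposition us) [e [eD eE]].
exists [seq pol x (e z) v | z <- s, v <- vbasis L]; split.
- apply/allP => _ /allpairsP [[z v] [/= _ vL ->]].
  by apply: pol_stable => //; apply: vbasis_mem.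
- apply/eqP; rewrite eqEsubv; apply/andP; split.
    apply/span_subvP => _ /allpairsP [[z v] [/= _ vL ->]].
    by apply: pol_stable => //; apply: vbasis_mem.
  rewrite -{1}(span_basis (vbasisP L)); apply/span_subvP => v vL.
  rewrite [v]eD big_seq; apply: memv_suml => z zs; apply: memv_span.
  by apply/allpairsP; exists (z, v).
by move=> _ /allpairsP [[z v] [/= zs _ ->]]; exists z; apply: eE.
Qed.

Lemma radical_ad_semisimple x (L : {vspace V}) :
  (forall v, v \in L -> br x v \in L) ->
  horner_mx (ad x) (radical (ad x)) = 0 -> ad_semisimple br L x.
Proof. by move=> xL; apply: annihilator_ad_semisimple; rewrite ?undup_uniq. Qed.

(** A polynomial with simple roots annihilating ad x still annihilates it on an invariant
    subspace. *)
Lemma ad_semisimple_restrict x (L : {vspace V}) :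
  (forall v, v \in L -> br x v \in L) ->
  ad_semisimple br fullv x -> ad_semisimple br L x.
Proof. by move=> xL /ad_semisimple_radical; apply: radical_ad_semisimple. Qed.

Lemma pol0 x p : pol x p 0 = 0.
Proof. by rewrite /pol; have := pol_linear x p (-1) 0 0; rewrite scaler0 addr0 scaleN1r addNr. Qed.

Lemma pol_scale x p a v : pol x p (a *: v) = a *: pol x p v.
Proof. by have := pol_linear x p a v 0; rewrite pol0 !addr0. Qed.

Lemma pol_sub x p u v : pol x p (u - v) = pol x p u - pol x p v.
Proof. by rewrite addrC -scaleN1r pol_linear scaleN1r addrC. Qed.

Lemma pol_br x p v : pol x p (br x v) = br x (pol x p v).
Proof.
have E w : br x w = pol x 'X w by rewrite /pol horner_mx_X op_ad.
by rewrite !E -!polM // mulrC.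
Qed.

(** On each eigencomponent the hypothesis reads z^2 v_z = 0. Equivalently, the kernel and the image
    of ad x meet only in 0. *)
Lemma ad_semisimple_kernel_sqr x v : ad_semisimple br fullv x ->
  br x (br x v) = 0 -> br x v = 0.
Proof.
move=> /ad_semisimple_radical /(eigen_decomposition (undup_uniq _)) [e [eD eE]] xxv.
rewrite [v]eD (br_sumr Hlie) big_seq big1 // => z zs; rewrite eE //.
have : br x (br x (pol x (e z) v)) = 0 by rewrite -!pol_br xxv pol0.
rewrite !eE // (br_scaler Hlie) eE // scalerA => /eqP.
by rewrite scaler_eq0 mulf_eq0 orbb -scaler_eq0 => /eqP.
Qed.

Lemma automorphism_pol (phi : V -> V) x p v : lie_automorphism br phi ->
  phi (pol x p v) = pol (phi x) p (phi v).
Proof.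
move=> [linphi _ phibr]; have phi0 : phi 0 = 0.
  by have := linphi (-1) 0 0; rewrite scaler0 addr0 scaleN1r addNr.
have phiZ a u : phi (a *: u) = a *: phi u.
  by have := linphi a u 0; rewrite phi0 !addr0.
elim/poly_ind: p v => [|p c IH] v; first by rewrite /pol !rmorph0 !op0.
have E y w : pol y (p * 'X + c%:P) w = 1 *: pol y p (br y w) + c *: w.
  rewrite {1}/pol rmorphD /= opD // horner_mx_C opC // -[op _ _]/(pol _ _ _).
  by rewrite polM // {2}/pol horner_mx_X op_ad // scale1r.
by rewrite !E linphi IH phibr phiZ.
Qed.

Lemma automorphism_surj (phi : V -> V) w : lie_automorphism br phi ->
  exists v, w = phi v.
Proof.
move=> [linphi injphi _].
pose g : {linear V -> V} := HB.pack phi (GRing.isLinear.Build F V V *:%R phi linphi).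
have ker0 : lker (linfun g) == 0%VS.
  by apply/lker0P => u v; rewrite !lfunE /= => /injphi.
have full : limg (linfun g) = fullv.
  apply/eqP; rewrite eqEdim subvf /= limg_dim_eq //.
  by rewrite (eqP ker0) capv0.
have := memvf w; rewrite -full => /memv_imgP [v _ ->].
by exists v; rewrite lfunE.
Qed.

Lemma automorphism_ad_semisimple (phi : V -> V) x : lie_automorphism br phi ->
  ad_semisimple br fullv (phi x) <-> ad_semisimple br fullv x.
Proof.
move=> autphi; have [linphi injphi _] := autphi.
have phi0 : phi 0 = 0.
  by have := linphi (-1) 0 0; rewrite scaler0 addr0 scaleN1r addNr.
split=> /ad_semisimple_radical r0.
  apply: (annihilator_ad_semisimple (undup_uniq (spectrum (ad (phi x))))).
    by move=> v _; rewrite memvf.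
  apply: (op_inj HX) => v; rewrite op0 // -[op _ _]/(pol _ _ _); apply: injphi.
  by rewrite automorphism_pol // /pol r0 op0 // phi0.
apply: (annihilator_ad_semisimple (undup_uniq (spectrum (ad x)))).
  by move=> v _; rewrite memvf.
apply: (op_inj HX) => w; have [v ->] := automorphism_surj w autphi.
by rewrite op0 // -[op _ _]/(pol _ _ _) -automorphism_pol // /pol r0 op0 // phi0.
Qed.

Lemma ad_polynomial_mx (W : {vspace V}) e : polynomial_mx W (fun v => ad (e + v)).
Proof.
move=> i j; apply: (@polynomial_on_ext _ _ W (fun v => ad e i j + ad v i j)).
  by move=> v _; have := ad_lin Hlie X 1 e v; rewrite !scale1r => ->; rewrite [RHS]mxE.
apply: polynomial_on_add; first exact: polynomial_on_const.
by apply: polynomial_on_linear => a u v; rewrite ad_lin // !mxE.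
Qed.

(* The rank of the Hankel matrix of traces counts the distinct eigenvalues, so
   it is lower semicontinuous, while the rank of the powers is the degree of the
   minimal polynomial; semisimplicity is the equality of the two. *)
Lemma dense_ad_semisimple_open (W : {vspace V}) (S : V -> Prop) e :
  zdense W S -> (forall v, S v -> ad_semisimple br fullv (e + v)) ->
  exists U : V -> Prop, [/\ zopen W U, exists F0, U F0
    & forall F0, U F0 -> ad_semisimple br fullv (e + F0)].
Proof.
move=> [SW dense] ssS.
pose H v := hankel (ad (e + v)); pose P v := powers_mx (ad (e + v)) n.+1.
have polyH : polynomial_mx W H.
  move=> i j; apply: (@polynomial_on_ext _ _ W
    (fun v => \sum_k (ad (e + v) ^+ (i + j)) k k)); first by move=> v _; rewrite mxE.
  by apply: polynomial_on_sum => k; apply/polynomial_mx_exp/ad_polynomial_mx.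
have polyP : polynomial_mx W P.
  move=> i j; case/mxvec_indexP: j => k l.
  apply: (@polynomial_on_ext _ _ W (fun v => (ad (e + v) ^+ i) k l)).
    by move=> v _; rewrite mxE mxvecE.
  exact/polynomial_mx_exp/ad_polynomial_mx.
(* The maximum [m] of the Hankel ranks serves twice: it is attained, so the open set is nonempty,
   and it bounds the rank of the powers on [S]. *)
have [||m [[v0 v0W rv0] mmax]] := @ex_max_nat
  (fun r => exists2 v, v \in W & \rank (H v) = r) n.+1.
- by exists (\rank (H 0)), 0; rewrite ?mem0v.
- by move=> k [v _ <-]; rewrite rank_leq_row.
have rP v : v \in W -> (\rank (P v) <= m)%N.
  move=> vW; rewrite leqNgt; apply/negP.
  apply: (dense (fun v => v \in W /\ ~ (m < \rank (P v))%N) _ _ v vW).2.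
    by apply: (zclosed_rank (m := m.+1) polyP).
  move=> u Su; have uW := SW _ Su; split=> //; apply/negP; rewrite -leqNgt.
  have /(radical_hankel _ charF0) := ad_semisimple_radical (ssS _ Su).
  by move/leq_trans; apply; apply: mmax; exists u.
exists (fun v => v \in W /\ (m <= \rank (H v))%N); split.
- split=> [v [] //|]; apply: (zclosed_rank (m := m) polyH) => v.
  by split=> -[vW nU]; split=> //; [move=> le | case=> _ le]; apply: nU.
- by exists v0; rewrite v0W rv0.
move=> v [vW le_m]; apply: radical_ad_semisimple => [w _|]; first exact: memvf.
by apply/(radical_hankel _ charF0); apply: leq_trans (rP v vW) le_m.
Qed.

(** With m = d/2 + 1, let s be a root of 1 + X + ... + X^(m-1), nonconstant as d > 1. Then s^m = 1,
    and s is not 1 since m is nonzero in [F]. A square root t of s has t^(d+2) = s^m = 1. *)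
Lemma root_of_unity_sqrt (d : nat) : ~~ odd d -> (1 < d)%N ->
  exists t : F, [/\ t != 0, t ^+ 2 != 1 & t ^+ 2 * t ^+ d = 1].
Proof.
move=> ev d1; set m := d./2.+1.
have dE : d = d./2.*2 by rewrite -[LHS]odd_double_half (negPf ev).
have [s ps] : exists s, root (\poly_(i < m) (1 : F)) s.
  apply/closed_rootP; rewrite size_poly_eq ?oner_neq0 //.
  by rewrite /m; case: d d1 ev {m dE} => [|[|d]].
have sm : s ^+ m = 1.
  apply/eqP; rewrite -subr_eq0 subrX1; move: ps; rewrite rootE horner_poly => /eqP E.
  by under eq_bigr do rewrite -[s ^+ _]mul1r; rewrite E mulr0.
have s1 : s != 1.
  apply: contraTneq ps => ->; rewrite rootE horner_poly.
  under eq_bigr do rewrite expr1n mulr1.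
  by rewrite sumr_const card_ord (pcharf0P F).1.
have [t pt] : exists t, root ('X^2 - s%:P) t.
  by apply/closed_rootP; rewrite size_XnsubC.
have ts : t ^+ 2 = s.
  by apply/eqP; move: pt; rewrite rootE !hornerE subr_eq0.
exists t; split.
- apply/eqP => t0; move: sm; rewrite -ts t0 expr0n /= exprS mul0r => /eqP.
  by rewrite eq_sym oner_eq0.
- by rewrite ts.
by rewrite -exprD {1}dE -[2%N]/(1.*2) -doubleD -muln2 mulnC exprM ts add1n.
Qed.

(** Weights are scalars of [F]; integer exponents for t^h are chosen on the finitely many that
    occur. *)
Lemma integral_labelling (s : seq F) : (forall z, z \in s -> exists j : int, z = j%:~R) ->
  exists g : F -> int, forall z, z \in s -> z = (g z)%:~R.
Proof.
elim: s => [|y s IH] H; first by exists (fun=> 0).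
have [|g Hg] := IH; first by move=> z zs; apply: H; rewrite inE zs orbT.
have [j Ej] := H y (mem_head _ _).
exists (fun z => if z == y then j else g z) => z; rewrite inE.
by case: eqP => [-> //|_] /Hg.
Qed.

(* With t^(d+2) = 1, the operator sigma = t^h satisfies sigma x = t^2 x sigma,
   while it commutes with the nilpotent part n of x, because n centralizes q and
   h is in q.  As t^2 <> 1, this forces n = 0. *)
Lemma ad_semisimple_lift (q : {vspace V}) e h f u (d : nat) :
  semisimple_sub br fullv -> sl2_triple br e h f -> ~~ odd d -> (1 < d)%N ->
  e \in q -> h \in q -> u \in q -> br h u = (- d%:R) *: u ->
  ad_semisimple br q (e + u) -> ad_semisimple br fullv (e + u).
Proof.
move=> simV Hs ev d1 eq hq uq hu ssq; set x := e + u.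
have [s Hs'] := semisimple_part charF0 Hlie HX x simV.
pose m := x - s.
have mE z k v : iter k (shift br x z) v = 0 -> br m v = shift br x z v.
  by move=> /Hs' sv; rewrite (br_subl Hlie) sv.
(* [q] is spanned by eigenvectors of [x], on which [s] acts by the same scalars; so the nilpotent
   part [m] centralizes [q]. *)
have mq v : v \in q -> br m v = 0.
  case: ssq => b [_ bq beig]; rewrite -bq; apply: span_kernel_ind.
    exact: br_linearr.
  move=> w /beig [c xw]; have E : shift br x c w = 0 by rewrite /shift xw subrr.
  by rewrite (mE c 1%N).
have [t [t0 t21 td]] := root_of_unity_sqrt ev d1.
have [|g Hg] := @integral_labelling (spectrum (ad h)).
  move=> z /(mem_eigenvalue Hlie HX) [v v0 hv].
  exact: (integral_weight charF0 Hlie HX Hs v0 hv).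
(* [p] and [p'] realize t^h and its inverse as polynomials in ad h. *)
have [p Hp] := spectral_operator Hlie HX h (fun z => t ^ g z).
have [p' Hp'] := spectral_operator Hlie HX h (fun z => (t ^ g z)^-1).
have sig_inj v : pol h p v = 0 -> v = 0.
  suff E : pol h p' (pol h p v) = v by move=> v0; rewrite -E v0 pol0.
  elim/(generalized_eigen_ind Hlie HX (x := h)) : v => [|a b IHa IHb|z k v vz].
  - by rewrite !pol0.
  - by rewrite -[a]scale1r !pol_linear !scale1r IHa IHb.
  by rewrite (Hp _ _ _ vz) pol_scale (Hp' _ _ _ vz) scalerA divff ?scale1r ?expfz_neq0.
have sig_br y (c : int) v : br h y = c%:~R *: y ->
    pol h p (br y v) = t ^ c *: br y (pol h p v).
  move=> hy; elim/(generalized_eigen_ind Hlie HX (x := h)) : v => [|a b IHa IHb|z k v vz].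
  - by rewrite !pol0 (br0r Hlie) pol0 scaler0.
  - rewrite (br_addr Hlie) -[br y a]scale1r !pol_linear !scale1r IHa IHb.
    by rewrite -[a in RHS]scale1r pol_linear scale1r (br_addr Hlie) scalerDr.
  case: (eqVneq (br y v) 0) => [yv|yv0].
    by rewrite yv (Hp _ _ _ vz) (br_scaler Hlie) yv !scaler0 pol0.
  have y1 : iter 1 (shift br h c%:~R) y = 0 by rewrite /= /shift hy subrr.
  have yvz := generalized_eigen_br Hlie y1 vz.
  have v0 : v != 0 by apply: contraNneq yv0 => ->; rewrite (br0r Hlie).
  have zs := Hg _ (generalized_eigenvalue_mem Hlie HX v0 vz).
  have czs := Hg _ (generalized_eigenvalue_mem Hlie HX yv0 yvz).
  rewrite (Hp _ _ _ yvz) (Hp _ _ _ vz) (br_scaler Hlie) scalerA -expfzDr //.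
  congr (t ^ _ *: _); apply/eqP; rewrite -subr_eq0 -(intr_eq0_char0 charF0).
  by rewrite rmorphB rmorphD /= -czs -zs subrr.
have t2 : t ^+ 2 != 0 by rewrite expf_neq0.
(* The weights 2 and -d give the same factor, since t^2 t^d = 1 means t^(-d) = t^2. *)
have sig_x v : pol h p (br x v) = t ^+ 2 *: br x (pol h p v).
  rewrite !(br_addl Hlie) -[br e v]scale1r pol_linear !scale1r scalerDr; congr (_ + _).
    by apply: (sig_br e 2); case: Hs => ->.
  rewrite (sig_br u (- d%:Z)); last by rewrite hu mulrNz pmulrn.
  congr (_ *: _); rewrite -invr_expz -exprnP.
  by apply: (mulIf (expf_neq0 d t0)); rewrite td mulVf // expf_neq0.
have shift_sig z v :
    shift br x (z / t ^+ 2) (pol h p v) = (t ^+ 2)^-1 *: pol h p (shift br x z v).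
  rewrite /shift pol_sub pol_scale sig_x scalerBr !scalerA mulVf // scale1r.
  by rewrite mulrC.
have shiftZ z a v : shift br x z (a *: v) = a *: shift br x z v.
  exact: (iter_shiftZ Hlie 1).
have m0 z k v : iter k (shift br x z) v = 0 -> br m v = 0.
  move=> vz; have sigz : iter k (shift br x (z / t ^+ 2)) (pol h p v) = 0.
    have -> : iter k (shift br x (z / t ^+ 2)) (pol h p v)
        = (t ^+ 2)^-1 ^+ k *: pol h p (iter k (shift br x z) v).
      elim: (k) => [|i IH]; first by rewrite scale1r.
      by rewrite !iterS IH shiftZ shift_sig scalerA -exprSr.
    by rewrite vz pol0 scaler0.
  apply: sig_inj; apply/eqP.
  (* Being of weight 0, [m] commutes with t^h; but on the image of [v], of eigenvalue z / t^2, it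
     acts as the shift, which produces the extra factor t^(-2). *)
  have E : pol h p (br m v) = (t ^+ 2)^-1 *: pol h p (br m v).
    rewrite {2}(mE _ _ _ vz) -shift_sig -(mE _ _ _ sigz).
    by rewrite (sig_br m 0) ?expr0z ?scale1r // mulr0z scale0r (br_anti Hlie) mq ?oppr0.
  move/eqP: E; rewrite -subr_eq0 -{1}[pol h p _]scale1r -scalerBl scaler_eq0 => /orP [|//].
  by rewrite subr_eq0 eq_sym invr_eq1 (negPf t21).
apply: radical_ad_semisimple => [v _|]; first exact: memvf.
apply: (op_inj HX) => v; rewrite op0 // -[op _ _]/(pol _ _ _).
elim/(generalized_eigen_ind Hlie HX (x := x)) : v => [|a b IHa IHb|z k v vz].
- exact: pol0.
- by rewrite -[a]scale1r pol_linear IHa IHb scaler0 addr0.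
apply: (@pol_radical_eigen x z); apply/eqP; rewrite -subr_eq0 -/(shift br x z v).
by rewrite -(mE _ _ _ vz) (m0 _ _ _ vz).
Qed.
End SemisimpleElements.

(** * Reduction to q *)


Section Reduction.
Variables (F : closedFieldType) (charF0 : [pchar F] =i pred0).
Variables (V : vectType F) (br : V -> V -> V).
Hypothesis Hlie : is_lie_bracket br.
Variables (n : nat) (X : n.+1.-tuple V) (HX : basis_of fullv X).

Lemma is_depth_unique (L : {vspace V}) h d d' :
  is_depth br L h d -> is_depth br L h d' -> d = d'.
Proof.
case=> nz z [nz' z']; case: (ltngtP d d') => // lt; [move: nz' | move: nz].
  by rewrite z ?eqxx // ltz_nat.
by rewrite z' ?eqxx // ltz_nat.
Qed.

Lemma depth_bound (L : {vspace V}) h d v (k : nat) : is_depth br L h d ->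
  v \in L -> v != 0 -> br h v = k%:R *: v -> (k <= d)%N.
Proof.
move=> [_ z] vL v0 hv; rewrite leqNgt; apply: contraNN v0 => lt.
rewrite -memv0 -(z k); last by rewrite ltz_nat.
by apply/(mem_grade Hlie); split; rewrite // hv pmulrn.
Qed.

Lemma mem_grade_opp (L : {vspace V}) h (d : nat) v :
  v \in grade br L h (- d%:Z) <-> v \in L /\ br h v = (- d%:R) *: v.
Proof. by rewrite mem_grade // mulrNz pmulrn. Qed.

(** A vector of weight -d in [L] reflects inside [L] to a weight k >= d, and the depth of the whole
    algebra gives k <= d. *)
Lemma stable_depth e h f (L : {vspace V}) d v : sl2_triple br e h f ->
  is_depth br fullv h d ->
  (forall x, x \in L -> br e x \in L) -> (forall x, x \in L -> br f x \in L) ->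
  v \in grade br L h (- d%:Z) -> v != 0 -> is_depth br L h d.
Proof.
move=> Hs Hd eL fL /mem_grade_opp [vL hv] v0.
have [k [u [dk uL u0 hu]]] := reversed_weight charF0 Hlie HX Hs eL fL vL v0 hv.
have kd : k = d.
  by apply/eqP; rewrite eqn_leq dk andbT (depth_bound Hd _ u0 hu) ?memvf.
split.
  apply: contraNneq u0 => E; have : u \in grade br L h d.
    by apply/(mem_grade Hlie); rewrite -kd.
  by rewrite E memv0.
case: Hd => _ z j /z E; apply/eqP; rewrite -subv0; apply/subvP => w.
by move=> /(mem_grade Hlie) [_ hw]; rewrite -E; apply/(mem_grade Hlie); rewrite memvf.
Qed.

(** Reflection is used twice: weight d leads to -k with d <= k, and back to some k' >= k, which the
    depth bounds by d; hence k = d. *)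
Lemma lowest_grade_neq0 e h f d : sl2_triple br e h f ->
  is_depth br fullv h d ->
  exists2 v, v \in grade br fullv h (- d%:Z) & v != 0.
Proof.
move=> Hs Hd; have [nz _] := Hd.
have stabf (y x : V) : x \in fullv -> br y x \in fullv by move=> _; apply: memvf.
have w0 : vpick (grade br fullv h d) != 0 by rewrite vpick0.
have /(mem_grade Hlie) [_ hw] := memv_pick (grade br fullv h d).
have [|k [u [dk _ u0 hu]]] := reversed_weight charF0 Hlie HX (sl2_triple_opp Hlie Hs)
  (stabf f) (stabf e) (memvf _) w0 (j := d).
  by rewrite (br_oppl Hlie) hw -pmulrn scaleNr.
have hu' : br h u = (- k%:R) *: u by rewrite scaleNr -hu (br_oppl Hlie) opprK.
have [k' [u' [kk _ u'0 hu'']]] := reversed_weight charF0 Hlie HX Hs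
  (stabf e) (stabf f) (memvf u) u0 hu'.
have k'd := depth_bound Hd (memvf _) u'0 hu''.
exists u => //; apply/mem_grade_opp; rewrite memvf hu'; split=> //.
by congr (- _%:R *: _); apply/eqP; rewrite eqn_leq dk (leq_trans kk k'd).
Qed.

Lemma depth_gt1 e h f d : e != 0 -> sl2_triple br e h f ->
  is_depth br fullv h d -> (1 < d)%N.
Proof.
by move=> e0 [he _ _] Hd; apply: (depth_bound Hd (memvf e) e0).
Qed.

Lemma zclosed_zero (W : {vspace V}) : zclosed W (fun v => v = 0).
Proof.
apply: (@zclosed_family _ _ W (fun g => exists i, g = coord (vbasis W) i)).
  by move=> _ [i ->]; apply: polynomial_on_coord.
move=> v; split=> [->|[vW v0]].
  by split=> [|_ [i ->]]; rewrite ?mem0v ?linear0.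
rewrite (coord_vbasis vW) big1 // => i _.
by rewrite (v0 (coord (vbasis W) i)) ?scale0r //; exists i.
Qed.

(** Otherwise the dense set would lie in the closed set {0}, although the lowest piece of the whole
    algebra is nonzero. *)
Lemma reducing_lowest_grade q e h f d : sl2_triple br e h f ->
  is_depth br fullv h d -> reducing br q e h f d ->
  exists2 u, u \in grade br q h (- d%:Z) & u != 0.
Proof.
move=> Hs Hd [_ _ [_ dense]]; have [w wW w0] := lowest_grade_neq0 Hs Hd.
case: (eqVneq (grade br q h (- d%:Z)) 0%VS) => [E|nz]; last first.
  by exists (vpick (grade br q h (- d%:Z))); rewrite ?memv_pick ?vpick0.
case/eqP: w0; apply: (dense _ (zclosed_zero _) _ w wW) => v [phi [u [[inn _ _ _] uq ->]]].
have [linphi _ _] := inner_aut_automorphism charF0 Hlie HX inn.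
have u0 : u = 0.
  apply/eqP; rewrite -memv0 -E; apply/mem_grade_opp.
  by move: uq; rewrite memv_cap => /andP [-> /mem_grade_opp [_ ->]].
by have := linphi (-1) 0 0; rewrite u0 scaler0 addr0 scaleN1r addNr.
Qed.

Lemma Zs_automorphism e h f phi : Zs br e h f phi ->
  lie_automorphism br phi /\ (forall u, phi (e + u) = e + phi u).
Proof.
case=> inn phie _ _; have autphi := inner_aut_automorphism charF0 Hlie HX inn.
split=> // u; case: autphi => linphi _ _.
by rewrite -[e]scale1r linphi phie.
Qed.

Lemma Zs_grade e h f phi (L : {vspace V}) j v : Zs br e h f phi ->
  v \in grade br L h j -> phi v \in grade br fullv h j.
Proof.
move=> Zphi /(mem_grade Hlie) [_ hv]; apply/(mem_grade Hlie); rewrite memvf; split=> //.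
have [[linphi _ phibr] _] := Zs_automorphism Zphi; case: Zphi => _ _ phih _.
rewrite -{1}phih -phibr hv; have := linphi j%:~R v 0.
suff -> : phi 0 = 0 by rewrite !addr0.
by have := linphi (-1) 0 0; rewrite scaler0 addr0 scaleN1r addNr.
Qed.

Lemma semisimple_cyclic_mem (q : {vspace V}) e h f u : semisimple_sub br q ->
  sl2_triple br e h f ->
  (forall x, x \in q -> br e x \in q) -> (forall x, x \in q -> br h x \in q) ->
  u \in q -> ad_semisimple br fullv (e + u) -> e \in q.
Proof.
move=> simq [he _ _] eq hq uq ss.
(* [e1] and [h1] are the components in [q]; the remainders [e2] and [h2] centralize [q] and are
   orthogonal to it. *)
have [e1 e1q He] := normalizer_decomposition charF0 Hlie HX simq eq.
have [h1 h1q Hh] := normalizer_decomposition charF0 Hlie HX simq hq.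
move: He Hh; set e2 := e - e1; set h2 := h - h1 => He Hh.
have eE : e = e1 + e2 by rewrite addrC subrK.
have hE : h = h1 + h2 by rewrite addrC subrK.
clearbody e2 h2.
have [subq _] := simq.
have e2q a : a \in q -> br e2 a = 0 by move=> /He [].
have h2q a : a \in q -> br h2 a = 0 by move=> /Hh [].
have qe2 a : a \in q -> br a e2 = 0 by move=> aq; rewrite (br_anti Hlie) e2q ?oppr0.
have qh2 a : a \in q -> br a h2 = 0 by move=> aq; rewrite (br_anti Hlie) h2q ?oppr0.
have sum : br h1 e1 + br h2 e2 = 2%:R *: e1 + 2%:R *: e2.
  move: he; rewrite eE hE scalerDr (br_addl Hlie) !(br_addr Hlie).
  by rewrite (qe2 h1) // (h2q e1) // addr0 add0r.
(* By [sum] the difference of the two sides is 2 e1 - [h1, e1], an element of [q]; it is also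
   orthogonal to [q], hence zero by nondegeneracy. *)
have h2e2 : br h2 e2 = 2%:R *: e2.
  apply/eqP; rewrite -subr_eq0; apply/eqP.
  apply: (killing_nondegenerate charF0 Hlie HX simq).
    have -> : br h2 e2 - 2%:R *: e2 = 2%:R *: e1 - br h1 e1.
      apply/eqP; rewrite subr_eq addrAC -sum [br h1 e1 + _]addrC addrK //.
    by rewrite memvB ?memvZ ?subq.
  move=> a aq; rewrite addrC -scaleNr (killing_linearl Hlie X) (He a aq).1 mulr0 add0r.
  by rewrite (killing_invariant Hlie HX) e2q // /killing (ad0 Hlie) mulmx0 mxtrace0.
have xh2 : br (e + u) h2 = - (2%:R *: e2).
  by rewrite eE !(br_addl Hlie) (qh2 e1) // (qh2 u) // add0r addr0 (br_anti Hlie) h2e2.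
have xe2 : br (e + u) e2 = 0.
  by rewrite eE !(br_addl Hlie) (qe2 e1) // (qe2 u) // add0r addr0 (br_self Hlie).
have := ad_semisimple_kernel_sqr Hlie HX ss (v := h2).
rewrite xh2 (br_oppr Hlie) (br_scaler Hlie) xe2 scaler0 oppr0 => /(_ erefl) /eqP.
rewrite oppr_eq0 scaler_eq0 (natr_eq0_char0 charF0) /= => /eqP e20.
by rewrite eE e20 addr0.
Qed.

(** The part of f centralizing [q] commutes with e, so h = [e, f] involves only the component of f
    in [q]. *)
Lemma triple_mem (q : {vspace V}) e h f : semisimple_sub br q ->
  sl2_triple br e h f -> (forall x, x \in q -> br f x \in q) -> e \in q -> h \in q.
Proof.
move=> simq [_ _ ef] fq eq; have [subq _] := simq.
have [f1 f1q Hf] := normalizer_decomposition charF0 Hlie HX simq fq.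
have -> : h = br e f1; last exact: subq.
have [_ E] := Hf e eq; apply/eqP; rewrite -ef -subr_eq0 -(br_subr Hlie).
by rewrite (br_anti Hlie) E oppr0.
Qed.

End Reduction.

Theorem theorem3p4 (F : closedFieldType) (charF0 : [pchar F] =i pred0)
  (V : vectType F) (br : V -> V -> V) (Hlie : is_lie_bracket br)
  (Hss : semisimple_sub br fullv)
  (e h f : V) (He0 : e != 0) (Hnil : ad_nilpotent br fullv e)
  (Hs : sl2_triple br e h f)
  (d : nat) (Hd : is_depth br fullv h d) (Hev : ~~ odd d)
  (q : {vspace V}) (Hq : reducing br q e h f d) :
  semisimple_type br fullv e h f <-> (e \in q /\ semisimple_type br q e h f).
Proof.
have [n [X HX]] : exists n, exists X : n.+1.-tuple V, basis_of fullv X.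
  move: (vbasis fullv) (vbasisP (fullv : {vspace V})).
  case: (\dim fullv) => [|n] X HX; last by exists n, X.
  case/eqP: He0; apply/eqP; rewrite -memv0 -span_nil.
  by move: HX; rewrite tuple0 => /span_basis ->; apply: memvf.
have [simq sq [SW dense]] := Hq.
have eL x : x \in q -> br e x \in q by case/sq.
have hL x : x \in q -> br h x \in q by case/sq.
have fL x : x \in q -> br f x \in q by case/sq.
have [subq _] := simq.
have [u0 u0W u00] := reducing_lowest_grade charF0 Hlie HX Hs Hd Hq.
have Hdq : is_depth br q h d := stable_depth charF0 Hlie HX Hs Hd eL fL u0W u00.
have gradeq u : u \in grade br q h (- d%:Z) -> u \in q by move/(mem_grade Hlie) => [].
split.
  case=> d' [Hd']; rewrite {Hd'}(is_depth_unique Hd' Hd) => -[U [Uop [F0 UF0] ssU]].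
  have [UW Ucl] := Uop.
  (* Otherwise the dense set would lie in the complement of [U], which is closed, and so would
     [F0]. *)
  have [phi [u [Zphi uq Uphi]]] : exists phi u, [/\ Zs br e h f phi,
      u \in (q :&: grade br fullv h (- d%:Z))%VS & U (phi u)].
    apply: NNPP => H; have [|_ nU] := dense _ Ucl _ F0 (UW _ UF0); last exact: nU.
    move=> v Sv; split; first exact: SW.
    by move=> Uv; apply: H; case: Sv => phi [u [Zphi uq E]]; exists phi, u; rewrite -E.
  have [autphi phie] := Zs_automorphism charF0 Hlie HX Zphi.
  have uq' : u \in grade br q h (- d%:Z).
    move: uq; rewrite memv_cap => /andP [? /(mem_grade Hlie) [_ ?]].
    exact/(mem_grade Hlie).
  have ss_g v : U (phi v) -> ad_semisimple br fullv (e + v).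
    move=> /ssU; rewrite -phie; exact: (automorphism_ad_semisimple Hlie HX _ autphi).1.
  have e_q : e \in q.
    apply: (semisimple_cyclic_mem charF0 Hlie HX simq Hs eL hL (gradeq _ uq')).
    exact: ss_g.
  split=> //; exists d; split=> //.
  (* A single element of Z(s) is enough: the preimage of [U] is open because [phi] is linear, and it
     contains [u]. *)
  exists (fun v => v \in grade br q h (- d%:Z) /\ U (phi v)); split.
  - split=> [v [] //|].
    have [Q polyQ HQ] := zclosedP Ucl.
    apply: (@zclosed_family _ _ _ (fun g' => exists2 g, Q g & g' = g \o phi)).
      move=> _ [g Qg ->]; apply: polynomial_on_comp (polyQ _ Qg); first by case: autphi.
      by move=> v; apply: (Zs_grade charF0 Hlie HX Zphi).
    move=> v; split=> [[vq nU]|[vq v0]].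
      have phiW := Zs_grade charF0 Hlie HX Zphi vq.
      split=> // _ [g Qg ->].
      have [_] := (HQ (phi v)).1 (conj phiW (fun Uv => nU (conj vq Uv))); exact.
    split=> // -[_ Uv]; have phiW := Zs_grade charF0 Hlie HX Zphi vq.
    have [_] := (HQ (phi v)).2 (conj phiW (fun g Qg => v0 _ (ex_intro2 _ _ g Qg erefl))).
    exact.
  - by exists u.
  move=> v [vq Uv]; apply: (ad_semisimple_restrict Hlie HX); last exact: ss_g.
  by move=> w wq; apply: subq => //; rewrite memvD // gradeq.
case=> e_q [d' [Hd']]; rewrite {Hd'}(is_depth_unique Hd' Hdq) => -[U [Uop [F0 UF0] ssU]].
have [UW Ucl] := Uop.
have h_q := triple_mem charF0 Hlie HX simq Hs fL e_q.
exists d; split=> //.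
apply: (dense_ad_semisimple_open charF0 Hlie HX (S := fun v =>
  exists phi u, [/\ Zs br e h f phi, U u & v = phi u])).
  split=> [v [phi [u [Zphi Uu ->]]]|C Ccl SC].
    exact: (Zs_grade charF0 Hlie HX Zphi (UW _ Uu)).
  apply: dense => // v [phi [u [Zphi uq ->]]].
  have uq' : u \in grade br q h (- d%:Z).
    move: uq; rewrite memv_cap => /andP [? /(mem_grade Hlie) [_ ?]].
    exact/(mem_grade Hlie).
  have [Q polyQ HQ] := zclosedP Ccl.
  apply/HQ; split=> [|g Qg]; first exact: (Zs_grade charF0 Hlie HX Zphi uq').
  have [[linphi _ _] _] := Zs_automorphism charF0 Hlie HX Zphi.
  (* For fixed [phi], an equation of [C] composed with [phi] vanishes on the open set [U], hence on
     the whole lowest piece of [q]. *)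
  apply: (polynomial_vanishing_on_open (g := g \o phi) Uop UF0) => //.
    apply: polynomial_on_comp (polyQ _ Qg) => // w.
    exact: (Zs_grade charF0 Hlie HX Zphi).
  move=> w Uw; have /HQ [_] : C (phi w) by apply: SC; exists phi, w.
  exact.
(* As [phi] fixes e, the element e + phi u is the image of e + u, to which the lifting from [q]
   applies. *)
move=> _ [phi [u [Zphi Uu ->]]].
have [autphi phie] := Zs_automorphism charF0 Hlie HX Zphi.
rewrite -phie; apply: (automorphism_ad_semisimple Hlie HX _ autphi).2.
have /(mem_grade_opp Hlie) [uq hu] := UW _ Uu.
apply: (ad_semisimple_lift charF0 Hlie HX Hss Hs Hev _ e_q h_q uq hu (ssU _ Uu)).
exact: (depth_gt1 Hlie He0 Hs Hd).
Qed.
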